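(* For every regular majorant $\omega$ there is a constant $c_\omega>0$, depending only on $\omega$, with the following property. Let $n\ge 1$ be an integer, let $f_0,\dots,f_{n+1}$ be functions analytic on (a neighborhood of) the closed disk $\mathbb D\cup\mathbb T$ with $f_{n+1}=f_0+\dots+f_n$, and assume that the Wronskian $W=W(f_0,\dots,f_n)$ vanishes nowhere on $\mathbb T$. For $0\le j\le n+1$ let $B_j$ be the finite Blaschke product associated with $f_j$, and put $$\mathbf B:=\mathrm{LCM}(B_0,\dots,B_{n+1}),\qquad \mathcal B:=\mathrm{rad}(B_0B_1\cdots B_{n+1}).$$ Then $$c_\omega\,\|\mathbf B\|_{\Lambda_\omega}\le\|1/W\|_\infty\cdot\left(\|W\|_{\Lambda_\omega}+n\,\|W\|_\infty\,\|\mathcal B\|_{\Lambda_\omega}\right).$$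
   Context: $\mathbb D=\{z\in\mathbb C:|z|<1\}$, $\mathbb T=\partial\mathbb D$, $\mathbb R_+=(0,\infty)$, $\|\cdot\|_\infty=\|\cdot\|_{L^\infty(\mathbb T)}$. Majorants: a majorant is an increasing continuous function $\omega:\mathbb R_+\to\mathbb R_+$ with $\lim_{t\to0^+}\omega(t)=0$ such that $\omega(t)/t$ is nonincreasing for $t>0$. A majorant $\omega$ is regular if there is a constant $C=C_\omega>0$ with $$\int_0^\delta\frac{\omega(t)}{t}\,dt+\delta\int_\delta^\infty\frac{\omega(t)}{t^2}\,dt\le C\,\omega(\delta),\qquad 0<\delta<2.$$ Lipschitz norm: for a function $f:\mathbb D\to\mathbb C$, $$\|f\|_{\Lambda_\omega}:=\|f\|_{\Lambda_\omega(\mathbb D)}:=\sup\left\{\frac{|f(z_1)-f(z_2)|}{\omega(|z_1-z_2|)}:\ z_1,z_2\in\mathbb D,\ z_1\ne z_2\right\}.$$ Wronskian: $W(f_0,\dots,f_n)=\det\big(f_j^{(i)}\big)_{0\le i,j\le n}$ (row $i$ consists of the $i$-th derivatives). Blaschke products: if $f_j$ has distinct zeros $a_1,\dots,a_s$ in the open disk $\mathbb D$ with multiplicities $m_1,\dots,m_s$, then $B_j(z)=\prod_{k=1}^s\left(\frac{z-a_k}{1-\overline{a_k}z}\right)^{m_k}$ (with $B_j=1$ if there are no zeros in $\mathbb D$). $\mathrm{LCM}(B_0,\dots,B_{n+1})$ is the least common multiple, i.e. the Blaschke product whose multiplicity at each point $a\in\mathbb D$ is the maximum of the multiplicities of $a$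 as a zero of $B_0,\dots,B_{n+1}$. For a Blaschke product $B$, its radical $\mathrm{rad}(B)$ is the Blaschke product having the same distinct zeros as $B$, each with multiplicity one. *)

(* Defs.v *)
From HB Require Import structures.
From mathcomp Require Import all_boot all_order all_algebra.
From mathcomp Require Import all_classical all_reals all_analysis.
From mathcomp Require Import complex.

Set Implicit Arguments.
Unset Strict Implicit.
Unset Printing Implicit Defensive.

Import Order.TTheory GRing.Theory Num.Theory.
Import numFieldTopology.Exports numFieldNormedType.Exports.

Local Open Scope classical_set_scope.
Local Open Scope ring_scope.
Local Open Scope complex_scope.

(* R[i] gets the normed space structure that numFieldNormedType gives to
   abstract number fields: the topology of the modulus, with R[i] as scalars,
   so that derive1 is the complex derivative. *)
HB.instance Definition _ (R : rcfType) :=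
  PseudoPointedMetric.copy R[i] R[i]^o.
HB.instance Definition _ (R : rcfType) := NormedModule.copy R[i] R[i]^o.

(* The norm `|z| of z : R[i] is an element of R[i]; its real version, used
   wherever a modulus must be a real number, is Normc.normc z : R. *)

Section Majorants.
Context {R : realType}.

(* Majorants are functions on (0, +oo), represented by w : R -> R of which only
   the values at positive reals matter. *)
Definition majorant (w : R -> R) : Prop :=
  [/\ forall t : R, 0 < t -> 0 < w t,
      {in `]0, +oo[ &, {homo w : s t / s <= t}},
      {in `]0, +oo[, continuous w},
      w t @[t --> 0^'+] --> (0 : R) &
      {in `]0, +oo[ &, forall s t, s <= t -> w t / t <= w s / s}].

Definition regular (w : R -> R) : Prop :=
  exists2 C : R, 0 < C & forall delta : R, 0 < delta -> delta < 2 ->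
    (\int[lebesgue_measure]_(t in `]0%R, delta[) (w t / t)%:E +
     delta%:E * \int[lebesgue_measure]_(t in `]delta, +oo[) (w t / t ^+ 2)%:E
     <= (C * w delta)%:E)%E.

End Majorants.

Section DiskFunctions.
Context {R : realType}.
Implicit Types (f g : R[i] -> R[i]) (a z : R[i]).

Definition norm_Lambda (w : R -> R) f : \bar R :=
  ereal_sup [set x | exists z1 z2 : R[i],
    [/\ `|z1| < 1, `|z2| < 1, z1 != z2 &
        x = (Normc.normc (f z1 - f z2) / w (Normc.normc (z1 - z2)))%:E]].

(* The circle carries its arc-length measure, read through t |-> exp(i t) on
   [0, 2 pi]. *)
Definition norm_circle_infty f : \bar R :=
  Lnorm (mrestr lebesgue_measure (measurable_itv `[0%R, 2 * pi : R]))
    +oo%E (fun t : R => (Normc.normc (f (cos t +i* sin t)))%:E).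

Definition analytic_at f a : Prop :=
  exists c : nat -> R[i],
    \forall z \near a, series (fun k => c k * (z - a) ^+ k) @ \oo --> f z.

Definition analytic_on_closed_disk f : Prop :=
  exists U : set R[i],
    [/\ open U, [set z | `|z| <= 1] `<=` U & forall a, U a -> analytic_at f a].

Definition vanishing_order f a (m : nat) : Prop :=
  exists g, [/\ analytic_at g a, g a != 0 &
                \forall z \near a, f z = (z - a) ^+ m * g z].

(* The value 0 covers both f a != 0 and the degenerate case where no order
   exists (e.g. f identically zero near a). *)
Definition multiplicity f a : nat := xget 0%N [set m | vanishing_order f a m].

(* The Blaschke product with a zero of multiplicity mu a at each a in the open
   disk, for mu with finitely many nonzero values there: the factors with
   mu a = 0 equal 1 and drop out of the finitely supported product. *)
Definition blaschke (mu : R[i] -> nat) z : R[i] :=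
  \big[*%R/1]_(a \in [set a : R[i] | `|a| < 1])
    (((z - a) / (1 - a^* * z)) ^+ mu a).

Definition blaschke_of f : R[i] -> R[i] := blaschke (multiplicity f).

Definition blaschke_lcm (n : nat) (B : 'I_n -> R[i] -> R[i]) : R[i] -> R[i] :=
  blaschke (fun a => \max_(j < n) multiplicity (B j) a)%N.

Definition blaschke_rad (B : R[i] -> R[i]) : R[i] -> R[i] :=
  blaschke (fun a => (0 < multiplicity B a)%N : nat).

Definition wronskian (n : nat) (f : 'I_n -> R[i] -> R[i]) z : R[i] :=
  \det (\matrix_(i < n, j < n) (f j)^`(i)%classic z).

End DiskFunctions.

(* Main.v *)
(** At a point a of the disk where some f_j has a zero of order m, the Wronskian
    W has a zero of order at least m - n (expand along the j-th column; for
    j = n+1 replace a column by the sum of all columns). Hence B = LCM(B_j)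
    divides F = W * rad(B_0...B_{n+1})^n, say F = B G, and |F| = |W| on the
    circle. With L a w-Lipschitz constant of F and d = 1 - |z|, |G| = |F| on the
    circle is compared, by the maximum principle, with an explicit rational
    function of positive real part that majorizes |F(z/|z|)| + L w(|.-z/|z||) on
    the circle and is at most |F(z/|z|)| + O(L w(d)) at z; this gives
    min |W| * (1 - |B(z)|) = O(L w(d)). A Schwarz-Pick estimate and summation
    along radii turn this into a w-Lipschitz bound for B. Regularity of w enters
    through its dyadic sums only. *)

Require Import Defs.
From HB Require Import structures.
From mathcomp Require Import all_boot all_order all_algebra.
From mathcomp Require Import all_classical all_reals all_analysis.
From mathcomp Require Import complex.
From mathcomp Require Import perm ess_sup_inf measurable_realfun.
From mathcomp Require Import ring lra.

Set Implicit Arguments.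
Unset Strict Implicit.
Unset Printing Implicit Defensive.

Import Order.TTheory GRing.Theory Num.Theory.
Import numFieldTopology.Exports numFieldNormedType.Exports.

Local Open Scope classical_set_scope.
Local Open Scope ring_scope.
Local Open Scope complex_scope.

(** Holomorphy is handled through Taylor expansions with geometric remainder bounds, and the maximum
    principle through second-order jets. The role that a Poisson integral of |F| would have is given
    to a rational function [Phi] with |F| <= Re Phi on the circle. Since |Phi| >= Re Phi > 0 on the
    closed disk, G / Phi is holomorphic there and bounded by 1 on the circle, so zeros of G are
    harmless. The constant does not depend on n because n enters only through the Lipschitz constant
    of F, by |x^n - y^n| <= n |x - y| on the unit disk. If C is the regularity constant of w, then c
    = 1 / ((2 + 32 C) (16 C + 4)). The first factor comes from the sum of w(2^k d) / 2^k, which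
    measures how much the part of the circle far from z/|z| contributes to [Phi] at z; the second
    comes from the sum of w(d / 2^k) along a radius. Regularity is given for delta < 2, which covers
    both uses: there 1 - |z| <= 1, and the radial parameter is at most 1/2. *)

Local Notation nc := Normc.normc.
Local Notation re := complex.Re.
Local Notation im := complex.Im.

(** * The modulus as a real number *)

Section Modulus.
Context {R : realType}.
Implicit Types (x y z a : R[i]) (r : R).

Lemma normcC z : `|z| = (nc z)%:C. Proof. by []. Qed.

Lemma normc_ltC z r : (`|z| < r%:C) = (nc z < r).
Proof. by rewrite normcC ltcR. Qed.

Lemma normc_leC z r : (`|z| <= r%:C) = (nc z <= r).
Proof. by rewrite normcC lecR. Qed.

Lemma normc_lt1 z : (`|z| < 1) = (nc z < 1).
Proof. exact: normc_ltC. Qed.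

Lemma normc_le1 z : (`|z| <= 1) = (nc z <= 1).
Proof. exact: normc_leC. Qed.

Lemma normc_eq1 z : `|z| = 1 <-> nc z = 1.
Proof. by rewrite normcC; split=> [[]|->]. Qed.

Lemma normc_ge0 z : 0 <= nc z.
Proof. by case: z => x y; rewrite /= sqrtr_ge0. Qed.

Lemma normc_eq0 z : (nc z == 0) = (z == 0).
Proof. by apply/eqP/eqP => [/Normc.eq0_normc|->] //; exact: Normc.normc0. Qed.

Lemma normc_gt0 z : (0 < nc z) = (z != 0).
Proof. by rewrite lt0r normc_ge0 andbT normc_eq0. Qed.

Lemma normcM x y : nc (x * y) = nc x * nc y.
Proof. exact: Normc.normcM. Qed.

Lemma normc_inv x : nc x^-1 = (nc x)^-1.
Proof. exact: Normc.normcV. Qed.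

Lemma normcX x n : nc (x ^+ n) = nc x ^+ n.
Proof. by elim: n => [|n IH]; rewrite ?expr0 ?Normc.normc1 // !exprS normcM IH. Qed.

Lemma normc_distC x y : nc (x - y) = nc (y - x).
Proof. by rewrite -normcN opprB. Qed.

Lemma normcD x y : nc (x + y) <= nc x + nc y.
Proof. exact: le_normcD. Qed.

Lemma normcB x y : nc (x - y) <= nc x + nc y.
Proof. by rewrite -[nc y]normcN normcD. Qed.

Lemma normc_sub_le x y : nc x - nc y <= nc (x - y).
Proof. by rewrite lerBlDr -[X in nc X <= _](subrK y x) normcD. Qed.

Lemma normc_triangle x y z : nc (x - z) <= nc (x - y) + nc (y - z).
Proof. by rewrite -[X in nc X <= _](subrKA y) normcD. Qed.

Lemma normc_sum (I : Type) (s : seq I) (P : pred I) (F : I -> R[i]) :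
  nc (\sum_(i <- s | P i) F i) <= \sum_(i <- s | P i) nc (F i).
Proof.
elim/big_ind2 : _ => [|x1 x2 y1 y2 h1 h2|//]; first by rewrite Normc.normc0.
by rewrite (le_trans (normcD _ _)) ?lerD.
Qed.

Lemma normc_real r : nc r%:C = `|r|.
Proof. by rewrite /= expr0n addr0 sqrtr_sqr. Qed.

Lemma normc_conj z : nc z^* = nc z.
Proof. by case: z => x y; rewrite /= sqrrN. Qed.

Lemma normc_sqr z : nc z ^+ 2 = re z ^+ 2 + im z ^+ 2.
Proof. by case: z => x y; rewrite /= sqr_sqrtr // addr_ge0 ?sqr_ge0. Qed.

Lemma normc_Re z : `|re z| <= nc z.
Proof.
rewrite -(@ler_pXn2r _ 2) ?nnegrE ?normc_ge0 //.
by rewrite normc_sqr real_normK ?num_real // lerDl sqr_ge0.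
Qed.

Lemma Re_le_normc z : re z <= nc z.
Proof. exact: le_trans (ler_norm _) (normc_Re z). Qed.

Lemma mulcJ_normc z : z * z^* = (nc z ^+ 2)%:C.
Proof.
rewrite normc_sqr; case: z => x y; simpc; apply/eqP; rewrite eq_complex /=.
by apply/andP; split; apply/eqP; ring.
Qed.

(** Radii of balls in [R[i]] are themselves elements of [R[i]]; positivity in its partial order
    forces the imaginary part to be 0, so the real part serves as a real radius. *)
Lemma nearcP a (P : set R[i]) :
  (\forall z \near a, P z) <-> exists2 r : R, 0 < r & forall z, nc (z - a) < r -> P z.
Proof.
split.
  move=> /nbhs_ballP[e /=]; rewrite ltcE /= => /andP[/eqP ie e0] eP.
  exists (re e) => // z zr; apply: eP; rewrite /ball /= distrC normcC.
  by rewrite ltcE /= eq_sym ie eqxx.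
case=> r r0 rP; apply/nbhs_ballP; exists r%:C => /=; first by rewrite ltcR.
by move=> z; rewrite /ball /= distrC normc_ltC => /rP.
Qed.

Lemma nearcW a (P : set R[i]) : (forall z, P z) -> \forall z \near a, P z.
Proof. by move=> h; apply/nearcP; exists 1. Qed.

Lemma nearcI a (P Q : set R[i]) :
  (\forall z \near a, P z) -> (\forall z \near a, Q z) -> \forall z \near a, P z /\ Q z.
Proof.
move=> /nearcP[r1 r10 h1] /nearcP[r2 r20 h2]; apply/nearcP.
exists (Num.min r1 r2) => [|z]; first by rewrite lt_min r10.
by rewrite lt_min => /andP[/h1 ? /h2].
Qed.

Lemma nearcS a (P Q : set R[i]) : (forall z, P z -> Q z) ->
  (\forall z \near a, P z) -> \forall z \near a, Q z.
Proof. by move=> h /nearcP[r r0 hr]; apply/nearcP; exists r => // z /hr/h. Qed.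

Lemma cvgcP (T : Type) (F : set_system T) (FF : Filter F) (f : T -> R[i]) a :
  f @ F --> a <-> forall e : R, 0 < e -> \forall x \near F, nc (f x - a) < e.
Proof.
split.
  move=> /cvgrPdist_lt h e e0; have e0' : 0 < e%:C by rewrite ltcR.
  by apply: filterS (h _ e0') => x; rewrite normc_ltC normc_distC.
move=> h; apply/cvgrPdist_lt => e; rewrite ltcE /= => /andP[/eqP ie e0].
apply: filterS (h _ e0) => x; rewrite normc_distC => hx.
by rewrite normcC ltcE /= eq_sym ie eqxx.
Qed.

End Modulus.

(** * Power series expansions *)

Section Expansions.
Context {R : realType}.
Implicit Types (f g : R[i] -> R[i]) (a z : R[i]) (c d : nat -> R[i]) (r M : R).

(* Geometric bounds on all Taylor remainders replace convergence of the series: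
   they are equivalent after shrinking r, and stable under the operations below
   without taking limits. *)
Definition expands_with f a c r M : Prop :=
  [/\ 0 < r, 0 <= M & forall N z, nc (z - a) < r ->
    nc (f z - \sum_(k < N) c k * (z - a) ^+ k) <= M * (nc (z - a) / r) ^+ N].

Definition expands f a c : Prop := exists r M, expands_with f a c r M.

Definition holo f a : Prop := exists c, expands f a c.

Lemma expands_with_le f a c r M r' M' : 0 < r' -> r' <= r -> M <= M' ->
  expands_with f a c r M -> expands_with f a c r' M'.
Proof.
move=> r'0 r'r MM' [r0 M0 h]; split=> //; first exact: le_trans MM'.
move=> N z zr; apply: le_trans (h N z (lt_le_trans zr r'r)) _.
apply: ler_pM => //; first by rewrite exprn_ge0 // divr_ge0 ?normc_ge0 // ltW.
apply: lerXn2r; rewrite ?nnegrE ?divr_ge0 ?normc_ge0 ?(ltW r0) ?(ltW r'0) //.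
by rewrite ler_wpM2l ?normc_ge0 // lef_pV2 ?posrE.
Qed.

Lemma expands_common f g a c d : expands f a c -> expands g a d ->
  exists r M, expands_with f a c r M /\ expands_with g a d r M.
Proof.
move=> [r1 [M1 h1]] [r2 [M2 h2]].
have [r10 M10 _] := h1; have [r20 M20 _] := h2.
exists (Num.min r1 r2), (M1 + M2); split.
  by apply: expands_with_le h1; rewrite ?lt_min ?r10 // ?ge_min ?lexx // lerDl.
by apply: expands_with_le h2; rewrite ?lt_min ?r10 // ?ge_min ?lexx ?orbT // lerDr.
Qed.

Lemma expands_near f g a c : (\forall z \near a, f z = g z) ->
  expands f a c -> expands g a c.
Proof.
move=> /nearcP[r1 r10 fg] [r [M h]]; have [r0 M0 _] := h.
have [|||r'0 _ h'] := @expands_with_le f a c r M (Num.min r1 r) M _ _ _ h.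
- by rewrite lt_min r10.
- by rewrite ge_min lexx orbT.
- by [].
exists (Num.min r1 r), M; split=> // N z zr; rewrite -fg; first exact: h'.
by move: zr; rewrite lt_min => /andP[].
Qed.

Lemma expands_val f a c : expands f a c -> f a = c 0%N.
Proof.
move=> [r [M [r0 M0 h]]]; apply/eqP; rewrite -subr_eq0 -normc_eq0.
rewrite eq_le normc_ge0 andbT; have := h 1%N a; rewrite subrr Normc.normc0.
by rewrite big_ord1 expr0 mulr1 mul0r expr1 mulr0; apply.
Qed.

(** The term of degree k is the difference of two consecutive remainders, evaluated here at distance
    r/2 from the centre. *)
Lemma expands_coef_le f a c r M k : expands_with f a c r M ->
  nc (c k) <= 2 * M / r ^+ k.
Proof.
move=> [r0 M0 h].
pose z := a + (r / 2)%:C.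
have uE : z - a = (r / 2)%:C by rewrite /z addrC addKr.
have ur : nc (z - a) = r / 2 by rewrite uE normc_real ger0_norm // divr_ge0 // ltW.
have u0 : 0 < r / 2 by rewrite divr_gt0.
have zr : nc (z - a) < r by rewrite ur; lra.
have := le_trans (normcB _ _) (lerD (h k z zr) (h k.+1 z zr)).
rewrite big_ord_recr /=; set S := (\sum_(i < k) _); set X := c k * _.
have -> : f z - S - (f z - (S + X)) = X by ring.
rewrite /X normcM normcX ur exprS => hh.
have e1 : r / 2 / r = 2^-1 by field; lra.
rewrite e1 in hh.
rewrite -(@ler_pM2r _ ((r / 2) ^+ k)) ?exprn_gt0 //; apply: le_trans hh _.
have -> : 2 * M / r ^+ k * (r / 2) ^+ k = 2 * (M * 2^-1 ^+ k).
  rewrite exprMn; have : r ^+ k != 0 by rewrite expf_neq0 ?gt_eqF.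
  by set X2 := 2^-1 ^+ k; set Y2 := r ^+ k => ?; field.
have : 0 <= M * 2^-1 ^+ k by rewrite mulr_ge0 // exprn_ge0.
set Y := 2^-1 ^+ k => ?; lra.
Qed.

Lemma expands_ext f a c d : (forall k, c k = d k) -> expands f a c -> expands f a d.
Proof. by move=> /funext ->. Qed.

Lemma expandsD f g a c d : expands f a c -> expands g a d ->
  expands (fun z => f z + g z) a (fun k => c k + d k).
Proof.
move=> hf hg; have [r [M [[r0 M0 h1] [_ _ h2]]]] := expands_common hf hg.
exists r, (M + M); split=> //; first exact: addr_ge0.
move=> N z zr; rewrite (eq_bigr (fun k : 'I_N => c k * (z - a) ^+ k + d k * (z - a) ^+ k)); last first.
  by move=> k _; rewrite mulrDl.
rewrite big_split /= opprD addrACA mulrDl.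
by apply: le_trans (normcD _ _) _; apply: lerD; [exact: h1 | exact: h2].
Qed.

Lemma expandsZ (b : R[i]) f a c : expands f a c ->
  expands (fun z => b * f z) a (fun k => b * c k).
Proof.
move=> [r [M [r0 M0 h]]]; exists r, (nc b * M); split; rewrite ?mulr_ge0 ?normc_ge0 //.
move=> N z zr; rewrite (eq_bigr (fun k : 'I_N => b * (c k * (z - a) ^+ k))); last first.
  by move=> k _; rewrite mulrA.
by rewrite -mulr_sumr -mulrBr normcM -mulrA ler_wpM2l ?normc_ge0 ?h.
Qed.

Lemma expandsB f g a c d : expands f a c -> expands g a d ->
  expands (fun z => f z - g z) a (fun k => c k - d k).
Proof.
move=> hf /(expandsZ (-1)) hg; have := expandsD hf hg.
move=> /(@expands_near _ (fun z => f z - g z)) h.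
apply: (@expands_ext _ _ (fun k => c k + -1 * d k)); first by move=> k; rewrite mulN1r.
by apply: h; apply: nearcW => z; rewrite mulN1r.
Qed.

Lemma expands_cst (b : R[i]) a :
  expands (fun=> b) a (fun k => if k == 0%N then b else 0).
Proof.
exists 1, (nc b); split; rewrite ?normc_ge0 // => -[|N] z zr.
  by rewrite big_ord0 subr0 expr0 mulr1.
rewrite big_ord_recl expr0 mulr1 big1 ?addr0 ?subrr ?Normc.normc0; last first.
  by move=> k _; rewrite mul0r.
by rewrite mulr_ge0 ?exprn_ge0 ?normc_ge0 ?divr_ge0 ?normc_ge0.
Qed.

Lemma expands_id (b : R[i]) a : expands (fun z => z - b) a
  (fun k => if k is k'.+1 then if k' == 0%N then 1 else 0 else a - b).
Proof.
exists 1, (1 + nc (a - b)); split; rewrite ?addr_ge0 ?normc_ge0 // => N z.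
rewrite divr1 => /ltW zr; have nn := normc_ge0 (z - a); have nb := normc_ge0 (a - b).
case: N => [|[|N]].
- rewrite big_ord0 subr0 expr0 mulr1 -(subrKA a).
  by apply: le_trans (normcD _ _) _; rewrite lerD2r.
- rewrite big_ord1 expr0 mulr1 opprB subrKA expr1 mulrDl mul1r lerDl.
  exact: mulr_ge0.
- rewrite !big_ord_recl big1 /=; last by move=> k _; rewrite mul0r.
  rewrite addr0 expr0 mulr1 mul1r expr1 [X in nc X](_ : _ = 0); last by ring.
  by rewrite Normc.normc0 mulr_ge0 ?exprn_ge0 // addr_ge0.
Qed.

Definition convol c d k := \sum_(i < k.+1) c i * d (k - i)%N.

(** Regrouping by the first index pairs the i-th term of one series with the partial sum of length N
    - i of the other, so that in [expandsM] each product of term and remainder has total order N. *)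
Lemma convol_sum c d (u : R[i]) N :
  \sum_(k < N) convol c d k * u ^+ k =
  \sum_(i < N) c i * u ^+ i * \sum_(j < N - i) d j * u ^+ j.
Proof.
elim: N => [|N IH]; first by rewrite !big_ord0.
rewrite big_ord_recr IH /= [RHS]big_ord_recr /= subSnn big_ord1 expr0 mulr1.
rewrite [X in _ = X + _](_ : _ = \sum_(i < N) c i * u ^+ i * (\sum_(j < N - i) d j * u ^+ j)
   + \sum_(i < N) c i * d (N - i)%N * u ^+ N); last first.
  rewrite -big_split; apply: eq_bigr => i _ /=.
  rewrite subSn ?big_ord_recr; last exact: ltnW.
  rewrite /= mulrDr; congr (_ + _).
  by rewrite mulrACA -exprD subnKC // ltnW.
rewrite -addrA; congr (_ + _).
rewrite /convol big_ord_recr /= subnn mulrDl mulr_suml; congr (_ + _); ring.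
Qed.

Lemma expandsM f g a c d : expands f a c -> expands g a d ->
  expands (fun z => f z * g z) a (convol c d).
Proof.
move=> hf hg; have [r [M [h1 h2]]] := expands_common hf hg.
have hc k := expands_coef_le k h1.
have [r0 M0 {}h1] := h1; have [_ _ {}h2] := h2.
have MM0 : 0 <= M * M by exact: mulr_ge0.
(* The remainder of the product collects 1 + 2 N contributions of size M^2 q^N. Halving the radius
   replaces q by 2 q, and 1 + 2 N <= 3 * 2^N absorbs the count. *)
exists (r / 2), (3 * (M * M)); split; [lra | by rewrite mulr_ge0 |].
move=> N z zr; set u := z - a.
have {}zr : nc u < r by rewrite /u; lra.
set q := nc u / r.
have q0 : 0 <= q by rewrite divr_ge0 ?normc_ge0 // ltW.
have -> : nc u / (r / 2) = 2 * q by rewrite /q; field; lra.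
rewrite convol_sum.
have -> : f z * g z - \sum_(i < N) c i * u ^+ i * (\sum_(j < N - i) d j * u ^+ j) =
  (f z - \sum_(i < N) c i * u ^+ i) * g z
  + \sum_(i < N) c i * u ^+ i * (g z - \sum_(j < N - i) d j * u ^+ j).
  rewrite mulrBl mulr_suml -addrA; congr (_ + _).
  rewrite -!sumrN -big_split; apply: eq_bigr => i _ /=; ring.
apply: le_trans (normcD _ _) _.
have gM : nc (g z) <= M.
  by have := h2 0%N z zr; rewrite big_ord0 subr0 expr0 mulr1.
have b1 : nc ((f z - \sum_(i < N) c i * u ^+ i) * g z) <= M * M * q ^+ N.
  rewrite normcM -mulrA [M * q ^+ N]mulrC mulrA.
  by apply: ler_pM; rewrite ?normc_ge0 //; exact: h1.
have b2 : nc (\sum_(i < N) c i * u ^+ i * (g z - \sum_(j < N - i) d j * u ^+ j))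
   <= \sum_(i < N) 2 * (M * M * q ^+ N).
  apply: le_trans (normc_sum _ _ _) _; apply: ler_sum => i _.
  rewrite !normcM normcX.
  have -> : 2 * (M * M * q ^+ N) = (2 * M / r ^+ i * nc u ^+ i) * (M * q ^+ (N - i)).
    rewrite -{1}(subnKC (ltnW (ltn_ord i))) exprD {1}/q expr_div_n; ring.
  apply: ler_pM; rewrite ?mulr_ge0 ?exprn_ge0 ?normc_ge0 //; last exact: h2.
  by rewrite ler_wpM2r ?exprn_ge0 ?normc_ge0.
apply: le_trans (lerD b1 b2) _; rewrite sumr_const card_ord -[_ *+ N]mulr_natr.
have := ltn_expl N (isT : (1 < 2)%N); rewrite -(ltr_nat R) natrX => Nl.
have p1 : (1 : R) <= 2 ^+ N by rewrite exprn_ege1 // ler1n.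
rewrite [(2 * q) ^+ N]exprMn.
have -> : M * M * q ^+ N + 2 * (M * M * q ^+ N) * N%:R = (1 + 2 * N%:R) * (M * M * q ^+ N) by ring.
have -> : 3 * (M * M) * (2 ^+ N * q ^+ N) = (3 * 2 ^+ N) * (M * M * q ^+ N) by ring.
by rewrite ler_wpM2r ?mulr_ge0 ?exprn_ge0 //; lra.
Qed.

Lemma expands_affineV (p q : R[i]) a : p + q * a != 0 ->
  holo (fun z => (p + q * z)^-1) a.
Proof.
set e := p + q * a => e0; exists (fun k => e^-1 * (- q / e) ^+ k).
have ne0 : 0 < nc e by rewrite normc_gt0.
have q1 : 0 < nc q + 1 by rewrite ltr_wpDl ?normc_ge0.
(* On this radius |q u| <= |e|/2, so the denominator e + q u keeps modulus at least |e|/2; the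
   summand 1 covers q = 0. *)
exists (nc e / (2 * (nc q + 1))), (2 / nc e); split.
- by rewrite divr_gt0 // mulr_gt0.
- by rewrite divr_ge0 // normc_ge0.
move=> N z; set u := z - a => ur.
have ur2 : nc q * nc u <= nc e / 2.
  move: ur; rewrite ltr_pdivlMr ?mulr_gt0 // => ur.
  have := normc_ge0 u; nra.
have zE : p + q * z = e + q * u by rewrite /e /u; ring.
have den : nc e / 2 <= nc (e + q * u).
  have := normc_sub_le e (- (q * u)); rewrite opprK normcN normcM; lra.
have dn0 : e + q * u != 0 by rewrite -normc_gt0; lra.
have -> : (p + q * z)^-1 - \sum_(k < N) e^-1 * (- q / e) ^+ k * u ^+ k =
   (e + q * u)^-1 * (- q * u / e) ^+ N.
  rewrite zE; under eq_bigr => k _ do rewrite -mulrA -exprMn.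
  rewrite -mulr_sumr; set x := - q / e * u.
  have -> : - q * u / e = x by rewrite /x; ring.
  have h := subrX1 x N.
  have x1 : x - 1 = - (e + q * u) / e by rewrite /x; field.
  have -> : e^-1 * (\sum_(i < N) x ^+ i) = (e + q * u)^-1 * (1 - x ^+ N).
    have -> : 1 - x ^+ N = - (x - 1) * \sum_(i < N) x ^+ i by rewrite mulNr -h; ring.
    rewrite x1; field; by rewrite e0 dn0.
  by ring.
rewrite normcM normcX normc_inv; apply: ler_pM; rewrite ?invr_ge0 ?exprn_ge0 ?normc_ge0 //.
  rewrite -[2 / _]invrK invf_div lef_pV2 ?posrE ?divr_gt0 //; lra.
apply: lerXn2r; rewrite ?nnegrE ?normc_ge0 ?divr_ge0 ?normc_ge0 ?mulr_ge0 ?(ltW q1) //.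
rewrite !normcM normcN normc_inv invf_div mulrA ler_pM2r ?invr_gt0 //.
rewrite mulrC ler_wpM2l ?normc_ge0 //; have := normc_ge0 q; lra.
Qed.

(** Once the lower coefficients vanish, the remainder bound of order k + 1 reads |c_k| s^k <= M
    (s/r)^(k+1) for small s > 0; divide by s^k and shrink s. *)
Lemma expands0_coef a c : expands (fun=> 0) a c -> forall k, c k = 0.
Proof.
move=> [r [M [r0 M0 h]]] k; elim/ltn_ind: k => k IH.
apply/eqP; rewrite -normc_eq0 eq_le normc_ge0 andbT.
apply/ler_addgt0Pl => e e0; rewrite addr0.
pose s := Num.min (r / 2) (e * r ^+ k.+1 / (M + 1)).
have rk : 0 < r ^+ k.+1 by exact: exprn_gt0.
have s0 : 0 < s by rewrite lt_min !divr_gt0 ?mulr_gt0 //; lra.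
have sr : s < r by apply: (@le_lt_trans _ _ (r / 2)); [rewrite ge_min lexx | lra].
have se : M * s <= e * r ^+ k.+1.
  have : s <= e * r ^+ k.+1 / (M + 1) by rewrite ge_min lexx orbT.
  by rewrite ler_pdivlMr; [nra | lra].
have uE : a + s%:C - a = s%:C by rewrite addrC addKr.
have := h k.+1 (a + s%:C); rewrite uE normc_real gtr0_norm // => /(_ sr).
rewrite big_ord_recr big1 /= ?add0r ?sub0r => [|i _]; last by rewrite IH // mul0r.
rewrite normcN normcM normcX normc_real gtr0_norm // expr_div_n mulrA.
rewrite ler_pdivlMr // exprS mulrA => hh.
rewrite -(ler_pM2r rk) -(@ler_pM2r _ (s ^+ k)) ?exprn_gt0 //.
have -> : nc (c k) * r ^+ k.+1 * s ^+ k = nc (c k) * s ^+ k * r * r ^+ k.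
  by rewrite exprS; ring.
apply: le_trans hh _; rewrite exprS mulrA.
by rewrite ler_wpM2r // exprn_ge0 // ltW.
Qed.

Lemma expands_uniq f a c d : expands f a c -> expands f a d -> forall k, c k = d k.
Proof.
move=> hc hd k; apply/eqP; rewrite -subr_eq0; apply/eqP.
apply: (@expands0_coef a (fun k => c k - d k)).
apply: expands_near (expandsB hc hd).
by apply: nearcW => z; rewrite subrr.
Qed.

End Expansions.

(** * Divisibility by powers of z - a, and closure properties of holomorphic functions *)

Section Holo.
Context {R : realType}.
Implicit Types (f g : R[i] -> R[i]) (a z : R[i]) (c d : nat -> R[i]) (r M : R).

(** The removable singularity is filled with c_m, so the factorization holds at every z and not only
    near a, as [divide_blaschke] requires. The remainder of order N of the quotient is the remainder
    of order m + N of f divided by (z - a)^m. *)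
Lemma expands_dvd m f a c : expands f a c -> (forall k, (k < m)%N -> c k = 0) ->
  exists g, expands g a (fun k => c (k + m)%N) /\
    forall z, f z = (z - a) ^+ m * g z.
Proof.
move=> hf c0; exists (fun z => if z == a then c m else f z / (z - a) ^+ m).
have fa := expands_val hf.
split; last first.
  move=> z; case: eqP => [->|/eqP za]; last first.
    by rewrite mulrC divfK // expf_neq0 // subr_eq0.
  rewrite subrr fa; case: m c0 => [_|m c0]; first by rewrite mul1r.
  by rewrite c0 // expr0n mul0r.
have [r [M h]] := hf; have hc := expands_coef_le m h; have [r0 M0 {}h] := h.
exists r, (2 * M / r ^+ m); split=> //.
  by rewrite divr_ge0 ?mulr_ge0 // exprn_ge0 // ltW.
move=> N z zr; case: eqP => [->|/eqP za].
  rewrite subrr Normc.normc0 mul0r; case: N => [|N].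
    by rewrite big_ord0 subr0 expr0 mulr1.
  rewrite big_ord_recl expr0 mulr1 add0n big1 => [|k _]; last by rewrite expr0n mulr0.
  by rewrite addr0 subrr Normc.normc0 expr0n mulr0.
set u := z - a; have u0 : u != 0 by rewrite subr_eq0.
have nu : 0 < nc u by rewrite normc_gt0.
have -> : f z / u ^+ m - \sum_(k < N) c (k + m)%N * u ^+ k =
  (f z - \sum_(k < m + N) c k * u ^+ k) / u ^+ m.
  rewrite big_split_ord /= [X in _ - (X + _)]big1 ?add0r => [|k _]; last by rewrite c0 // mul0r.
  rewrite mulrBl mulr_suml; congr (_ - _); apply: eq_bigr => k _.
  rewrite exprD addnC; field; by rewrite expf_neq0.
rewrite normcM normc_inv normcX ler_pdivrMr ?exprn_gt0 //.
apply: le_trans (h _ z zr) _; rewrite exprD -/u.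
have -> : 2 * M / r ^+ m * (nc u / r) ^+ N * nc u ^+ m =
   2 * M * ((nc u / r) ^+ m * (nc u / r) ^+ N).
  by rewrite (expr_div_n _ _ m); ring.
rewrite ler_wpM2r ?mulr_ge0 ?exprn_ge0 ?divr_ge0 ?normc_ge0 ?(ltW r0) //; lra.
Qed.

Lemma expands_mulX f a c : expands f a c ->
  expands (fun z => (z - a) * f z) a (fun k => if k is k'.+1 then c k' else 0).
Proof.
move=> hf; apply: expands_ext (expandsM (expands_id a a) hf) => -[|k].
  by rewrite /convol big_ord1 subrr mul0r.
rewrite /convol !big_ord_recl big1 /= ?addr0 => [|i _]; last by rewrite mul0r.
by rewrite subrr mul0r add0r mul1r subSS subn0.
Qed.

(** A lower bound on the order of vanishing. Unlike an exact order it is preserved by sums and holds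
    for functions that vanish identically near a. *)
Definition dvd_at m f a : Prop :=
  exists c, expands f a c /\ forall k, (k < m)%N -> c k = 0.

Lemma dvd_atP m f a : dvd_at m f a <->
  exists g, holo g a /\ \forall z \near a, f z = (z - a) ^+ m * g z.
Proof.
split=> [[c [hc c0]]|[g [[d hd] hg]]].
  have [g [hg gE]] := expands_dvd hc c0.
  by exists g; split; [exists (fun k => c (k + m)%N) | exact: nearcW].
suff [c [hc c0]] : dvd_at m (fun z => (z - a) ^+ m * g z) a.
  exists c; split => //; apply: expands_near hc.
  by apply: nearcS hg => z ->.
elim: m {hg} => [|m [c [hc c0]]].
  by exists d; split=> //; apply: expands_near hd; apply: nearcW => z; rewrite mul1r.
exists (fun k => if k is k'.+1 then c k' else 0); split=> [|[|k] //]; last exact: c0.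
apply: expands_near (expands_mulX hc); apply: nearcW => z; by rewrite exprS mulrA.
Qed.

Lemma holo_near f g a : (\forall z \near a, f z = g z) -> holo f a -> holo g a.
Proof. by move=> h [c hc]; exists c; exact: expands_near hc. Qed.

Lemma holo_cst (b : R[i]) a : holo (fun=> b) a.
Proof. by eexists; exact: expands_cst. Qed.

Lemma holo_subc (b : R[i]) a : holo (fun z => z - b) a.
Proof. by eexists; exact: expands_id. Qed.

Lemma holoD f g a : holo f a -> holo g a -> holo (fun z => f z + g z) a.
Proof. by move=> [c hc] [d hd]; eexists; exact: expandsD hc hd. Qed.

Lemma holoM f g a : holo f a -> holo g a -> holo (fun z => f z * g z) a.
Proof. by move=> [c hc] [d hd]; eexists; exact: expandsM hc hd. Qed.

Lemma holoX f a m : holo f a -> holo (fun z => f z ^+ m) a.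
Proof.
move=> hf; elim: m => [|m IH]; first exact: (holo_cst 1).
by apply: holo_near (holoM hf IH); apply: nearcW => z; rewrite exprS.
Qed.

Lemma holo_sum (I : Type) (s : seq I) (F : I -> R[i] -> R[i]) a :
  (forall i, holo (F i) a) -> holo (fun z => \sum_(i <- s) F i z) a.
Proof.
move=> hF; elim: s => [|i s IH].
  by apply: holo_near (holo_cst 0 a); apply: nearcW => z; rewrite big_nil.
by apply: holo_near (holoD (hF i) IH); apply: nearcW => z; rewrite big_cons.
Qed.

Lemma holo_prod (I : eqType) (s : seq I) (F : I -> R[i] -> R[i]) a :
  (forall i, i \in s -> holo (F i) a) -> holo (fun z => \prod_(i <- s) F i z) a.
Proof.
elim: s => [|i s IH] hF.
  by apply: holo_near (holo_cst 1 a); apply: nearcW => z; rewrite big_nil.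
have h1 : holo (F i) a by apply: hF; rewrite inE eqxx.
have h2 : holo (fun z => \prod_(j <- s) F j z) a.
  by apply: IH => j js; apply: hF; rewrite inE js orbT.
by apply: holo_near (holoM h1 h2); apply: nearcW => z; rewrite big_cons.
Qed.

Lemma holo_det n (F : 'I_n -> 'I_n -> R[i] -> R[i]) a :
  (forall i j, holo (F i j) a) -> holo (fun z => \det (\matrix_(i, j) F i j z)) a.
Proof.
move=> hF.
have h (s : 'S_n) : holo (fun z => (-1) ^+ s * \prod_(i <- index_enum 'I_n) F i (s i) z) a.
  by apply: holoM; [exact: holo_cst | apply: holo_prod => i _; exact: hF].
apply: holo_near (holo_sum (index_enum _) h); apply: nearcW => z.
by apply: eq_bigr => s _; congr (_ * _); apply: eq_bigr => i _; rewrite mxE.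
Qed.

Lemma holo_lip f a : holo f a -> exists r C : R, [/\ 0 < r, 0 <= C &
  forall z, nc (z - a) < r -> nc (f z - f a) <= C * nc (z - a)].
Proof.
move=> [c hc]; have fa := expands_val hc; have [r [M [r0 M0 h]]] := hc.
exists r, (M / r); split=> // [|z zr]; first by rewrite divr_ge0 // ltW.
by have := h 1%N z zr; rewrite big_ord1 expr0 mulr1 -fa expr1 mulrCA mulrC.
Qed.

Lemma holo_cts f a : holo f a -> forall e : R, 0 < e ->
  exists2 r : R, 0 < r & forall z, nc (z - a) < r -> nc (f z - f a) < e.
Proof.
move=> /holo_lip[r [C [r0 C0 h]]] e e0; exists (Num.min r (e / (C + 1))).
  by rewrite lt_min r0 divr_gt0 //; lra.
move=> z; rewrite lt_min => /andP[/h h1]; rewrite ltr_pdivlMr; last lra.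
by have := normc_ge0 (z - a); nra.
Qed.

Lemma holo_neq0_near f a : holo f a -> f a != 0 -> \forall z \near a, f z != 0.
Proof.
move=> hf fa; have e0 : 0 < nc (f a) by rewrite normc_gt0.
have [r r0 h] := holo_cts hf e0; apply/nearcP; exists r => // z /h.
apply: contraTneq => ->; by rewrite sub0r normcN ltxx.
Qed.

(** Converts a bound on differences into a bound on the derivative; [expands_deriv] applies it to a
    Taylor remainder re-expanded at a nearby point. *)
Lemma expands_coef1_le f a c (L : R) : expands f a c ->
  (\forall z \near a, nc (f z - f a) <= L * nc (z - a)) -> nc (c 1%N) <= L.
Proof.
move=> hc /nearcP[r1 r10 hL]; have fa := expands_val hc.
have [r [M [r0 M0 h]]] := hc.
apply/ler_addgt0Pl => e e0.
pose s := Num.min (Num.min (r / 2) (r1 / 2)) (e * r ^+ 2 / (M + 1)).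
have r2 : 0 < r ^+ 2 by exact: exprn_gt0.
have s0 : 0 < s by rewrite !lt_min !divr_gt0 ?mulr_gt0 //; lra.
have sr : s < r by apply: (@le_lt_trans _ _ (r / 2)); [rewrite !ge_min lexx | lra].
have sr1 : s < r1 by apply: (@le_lt_trans _ _ (r1 / 2)); [rewrite !ge_min lexx orbT | lra].
have se : M * s <= e * r ^+ 2.
  have : s <= e * r ^+ 2 / (M + 1) by rewrite !ge_min lexx !orbT.
  by rewrite ler_pdivlMr; [nra | lra].
have uE : a + s%:C - a = s%:C by rewrite addrC addKr.
have := h 2%N (a + s%:C); have := hL (a + s%:C).
rewrite uE normc_real gtr0_norm // => /(_ sr1) h1 /(_ sr).
rewrite !big_ord_recl big_ord0 /= expr0 mulr1 addr0 expr1 -fa => h2.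
set D := f (a + s%:C) in h1 h2.
have h3 : nc (c 1%N * s%:C) <= L * s + M * (s / r) ^+ 2.
  have -> : c 1%N * s%:C = (D - f a) - (D - (f a + c 1%N * s%:C)) by ring.
  by apply: le_trans (normcB _ _) _; exact: lerD.
move: h3; rewrite normcM normc_real gtr0_norm // expr_div_n.
have -> : L * s + M * (s ^+ 2 / r ^+ 2) = (L + M * s / r ^+ 2) * s by ring.
rewrite ler_pM2r // => h3; apply: le_trans h3 _; rewrite addrC lerD2r.
by rewrite ler_pdivrMr.
Qed.

Lemma expands_derive1 f a c : expands f a c -> f^`()%classic a = c 1%N.
Proof.
move=> hc; have fa := expands_val hc; have [r [M [r0 M0 h]]] := hc.
rewrite derive1E; apply: cvg_lim => //.
apply/cvgcP => e e0; apply/nearcP.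
exists (Num.min r (e * r ^+ 2 / (M + 1))) => [|z].
  by rewrite lt_min r0 divr_gt0 ?mulr_gt0 ?exprn_gt0 //; lra.
rewrite subr0 lt_min => /andP[zr zs] z0.
have n0 : 0 < nc z by rewrite normc_gt0.
have ue : z *: 1 + a - a = z :> R[i] by rewrite addrK -[RHS]mulr1.
have := h 2%N (z *: 1 + a); rewrite ue => /(_ zr).
rewrite !big_ord_recl big_ord0 /= expr0 mulr1 addr0 expr1 -fa => h2.
set D := f _ in h2 *.
have -> : z^-1 *: (D - f a) - c 1%N = z^-1 * (D - (f a + c 1%N * z)).
  have -> : z^-1 *: (D - f a) = z^-1 * (D - f a) by [].
  by field.
rewrite normcM normc_inv mulrC ltr_pdivrMr //; apply: le_lt_trans h2 _.
have r2 : 0 < r ^+ 2 by exact: exprn_gt0.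
move: zs; rewrite ltr_pdivlMr; last lra.
have -> : M * (nc z / r) ^+ 2 = M * nc z * nc z / r ^+ 2.
  by field; rewrite gt_eqF.
rewrite ltr_pdivrMr // => zs; rewrite [e * _ * _]mulrAC ltr_pM2r //.
by move: zs n0; clear -M0; rewrite mulrDr; lra.
Qed.

End Holo.

(** * Convergent series and derivatives *)

Section Derivatives.
Context {R : realType}.
Implicit Types (f g : R[i] -> R[i]) (a z w : R[i]) (c d : nat -> R[i]) (r M : R).

Lemma geo_sum_le K : \sum_(j < K) 2^-1 ^+ j <= (2 : R).
Proof.
suff -> : \sum_(j < K) 2^-1 ^+ j = 2 - 2 * 2^-1 ^+ K :> R.
  by rewrite gerBl mulr_ge0 // exprn_ge0.
elim: K => [|K IH]; first by rewrite big_ord0 expr0; ring.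
by rewrite big_ord_recr /= IH exprS; field.
Qed.

Lemma le_geo_limit (x y M : R) : 0 <= M ->
  (forall K, x <= y + M * 2^-1 ^+ K) -> x <= y.
Proof.
move=> M0 h; apply/ler_addgt0Pl => e e0.
pose K := Num.bound (M / e).
have hK : M / e < K%:R by apply: archi_boundP; rewrite divr_ge0 // ltW.
apply: le_trans (h K) _; rewrite addrC lerD2r.
have Kl := ltn_expl K (isT : (1 < 2)%N); rewrite -(ltr_nat R) natrX in Kl.
have pK : 0 < (2 : R) ^+ K by rewrite exprn_gt0.
rewrite exprVn ler_pdivrMr // mulrC -ler_pdivrMr //.
exact: ltW (lt_trans hK Kl).
Qed.

(** Abel's lemma: convergence at the single point a + p bounds all |c_k| p^k, and on the disk of
    radius p/2 the tails are then dominated by a geometric series. *)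
Lemma holo_analytic f a : analytic_at f a -> holo f a.
Proof.
move=> [c /nearcP[r0 r00 h]]; exists c.
pose p := r0 / 2; have p0 : 0 < p by rewrite divr_gt0.
pose S z n := \sum_(k < n) c k * (z - a) ^+ k.
have {}h z (e : R) : nc (z - a) < r0 -> 0 < e ->
    exists N, forall n, (N <= n)%N -> nc (S z n - f z) < e.
  move=> zr e0; have /cvgcP/(_ e e0) := h z zr.
  move=> [N _ hN]; exists N => n Nn; have := hN n Nn.
  by rewrite /series /= big_mkord.
have [M M0 hM] : exists2 M : R, 0 <= M & forall k, nc (c k) * p ^+ k <= M.
  have z1 : nc (a + p%:C - a) = p by rewrite addrC addKr normc_real gtr0_norm.
  have [|N hN] := h (a + p%:C) 1 _ ltr01; first by rewrite z1 /p; lra.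
  have s0 : 0 <= \sum_(k < N) nc (c k) * p ^+ k.
    by apply: sumr_ge0 => k _; rewrite mulr_ge0 ?normc_ge0 // exprn_ge0 // ltW.
  (* From index N on, a term is the difference of two partial sums within 1 of the limit, which
     accounts for the 2; the finite sum covers the earlier terms. *)
  exists (2 + \sum_(k < N) nc (c k) * p ^+ k) => [|k]; first lra.
  have [kN|Nk] := ltnP k N.
    rewrite (bigD1 (Ordinal kN)) //=.
    set X := nc _ * _; set Y := \sum_(_ < _ | _) _.
    suff : 0 <= Y by lra.
    by apply: sumr_ge0 => i _; rewrite mulr_ge0 ?normc_ge0 // exprn_ge0 // ltW.
  have h1 := hN k Nk; have h2 := hN k.+1 (leqW Nk).
  have -> : nc (c k) * p ^+ k = nc (S (a + p%:C) k.+1 - S (a + p%:C) k).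
    rewrite /S big_ord_recr /= [X in _ = nc X](_ : _ = c k * (a + p%:C - a) ^+ k).
      by rewrite normcM normcX z1.
    by ring.
  apply: le_trans (normc_triangle _ (f (a + p%:C)) _) _.
  by rewrite [X in _ + X]normc_distC; lra.
exists (p / 2), (2 * M); split; [lra | exact: mulr_ge0 |].
move=> N z zr; rewrite -/(S z N).
set q := nc (z - a) / p.
have q0 : 0 <= q by rewrite divr_ge0 ?normc_ge0 // ltW.
have q2 : q <= 2^-1 by rewrite ler_pdivrMr //; lra.
have -> : nc (z - a) / (p / 2) = 2 * q by rewrite /q; field; rewrite gt_eqF.
have tail K : nc (S z (N + K)%N - S z N) <= 2 * M * q ^+ N.
  rewrite /S big_split_ord /= addrAC subrr add0r; apply: le_trans (normc_sum _ _ _) _.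
  apply: (@le_trans _ _ (\sum_(j < K) M * q ^+ N * 2^-1 ^+ j)).
    apply: ler_sum => j _; rewrite normcM normcX.
    have -> : nc (z - a) = p * q by rewrite /q mulrC divfK // gt_eqF.
    rewrite exprMn mulrA; apply: (@le_trans _ _ (M * q ^+ (N + j))).
      by rewrite ler_wpM2r // exprn_ge0.
    rewrite exprD mulrA ler_wpM2l ?mulr_ge0 ?exprn_ge0 //.
    by rewrite lerXn2r ?nnegrE.
  rewrite -mulr_sumr mulrC -mulrA ler_wpM2r ?mulr_ge0 ?exprn_ge0 //.
  exact: geo_sum_le.
apply: (@le_trans _ _ (2 * M * q ^+ N)); last first.
  have qq : q <= 2 * q by rewrite ler_peMl // ler1n.
  apply: ler_wpM2l; first by rewrite mulr_ge0.
  have q20 : 0 <= 2 * q by apply: le_trans qq.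
  by apply: lerXn2r; rewrite ?nnegrE.
apply/ler_addgt0Pl => e e0.
have [|n hn] := h z e _ e0; first by rewrite /p in zr; lra.
apply: le_trans (normc_triangle _ (S z (N + n)%N) _) _.
by apply: lerD; [rewrite normc_distC ltW // hn // leq_addl | exact: tail].
Qed.

Lemma analytic_holo f a : holo f a -> analytic_at f a.
Proof.
move=> [c [r [M [r0 M0 h]]]]; exists c; apply/nearcP; exists (r / 2) => [|z zr]; first lra.
apply/cvgcP => e e0.
have q0 : 0 <= nc (z - a) / r by rewrite divr_ge0 ?normc_ge0 // ltW.
have q2 : nc (z - a) / r <= 2^-1 by rewrite ler_pdivrMr //; lra.
pose N := Num.bound (M / e).
have hN : M / e < N%:R by apply: archi_boundP; rewrite divr_ge0 // ltW.
exists N => // n /= Nn; rewrite /series /= big_mkord normc_distC.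
have zr' : nc (z - a) < r by lra.
apply: le_lt_trans (h n z zr') _.
apply: (@le_lt_trans _ _ (M * 2^-1 ^+ n)).
  by rewrite ler_wpM2l // lerXn2r ?nnegrE.
have Kl := ltn_expl n (isT : (1 < 2)%N); rewrite -(ltr_nat R) natrX in Kl.
have pK : 0 < (2 : R) ^+ n by rewrite exprn_gt0.
rewrite exprVn ltr_pdivrMr // mulrC -ltr_pdivrMr //.
apply: lt_trans hN _; apply: le_lt_trans Kl; by rewrite ler_nat.
Qed.

(** Re-expansion of a Taylor polynomial at another centre z. Only the first coefficient is recorded,
    since that is the derivative compared with f' in [expands_deriv]. *)
Lemma expands_poly (c : nat -> R[i]) a z N : exists d,
  expands (fun w => \sum_(k < N) c k * (w - a) ^+ k) z d /\
  d 1%N = \sum_(k < N) c k * (k%:R * (z - a) ^+ k.-1).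
Proof.
have pow k : exists d, expands (fun w => (w - a) ^+ k) z d /\
    d 1%N = k%:R * (z - a) ^+ k.-1.
  elim: k => [|k [d [hd d1]]].
    by exists (fun k => if k == 0%N then 1 else 0); split; [exact: expands_cst | rewrite mul0r].
  eexists; split.
    apply: expands_near (expandsM (expands_id a z) hd).
    by apply: nearcW => w; rewrite exprS.
  rewrite /convol !big_ord_recl big_ord0 /= subn0 subnn addr0 d1 mul1r.
  have e0 := expands_val hd; rewrite /= in e0; rewrite -e0 -natr1 [RHS]mulrDl mul1r.
  case: k {hd d1 e0} => [|k] /=; first by rewrite !mul0r mulr0.
  by rewrite exprS; ring.
elim: N => [|N [d [hd d1]]].
  exists (fun k => if k == 0%N then 0 else 0); split; last by rewrite big_ord0.
  by apply: expands_near (expands_cst 0 z); apply: nearcW => w; rewrite big_ord0.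
have [d' [hd' d1']] := pow N.
exists (fun k => d k + c N * d' k); split; last by rewrite d1 d1' big_ord_recr.
apply: expands_near (expandsD hd (expandsZ (c N) hd')).
by apply: nearcW => w; rewrite big_ord_recr.
Qed.

Lemma normc_subX_le (u v : R[i]) (s : R) k : nc u <= s -> nc v <= s ->
  nc (u ^+ k.+1 - v ^+ k.+1) <= k.+1%:R * s ^+ k * nc (u - v).
Proof.
move=> us vs; have s0 := le_trans (normc_ge0 _) us.
rewrite subrXX normcM mulrC ler_wpM2r ?normc_ge0 //.
apply: le_trans (normc_sum _ _ _) _.
apply: (@le_trans _ _ (\sum_(i < k.+1) s ^+ k)); last first.
  by rewrite sumr_const card_ord mulr_natl.
apply: ler_sum => i _; rewrite normcM !normcX.
have ik : (i <= k)%N by rewrite -ltnS.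
have -> : s ^+ k = s ^+ (k - i) * s ^+ i by rewrite -exprD subnK.
by apply: ler_pM; rewrite ?exprn_ge0 ?normc_ge0 //;
  rewrite lerXn2r ?nnegrE ?normc_ge0.
Qed.

(** The next K terms are compared one by one, and what lies beyond them is at most 2 M / 2^K, which
    disappears as K grows. A difference of (k+1)-st powers costs a factor k + 1 <= 2^k; this is why
    the bound contains 2 s instead of s. *)
Lemma expands_tail_lip f a c r M N (s : R) z w : expands_with f a c r M ->
  s <= r / 4 -> nc (z - a) <= s -> nc (w - a) <= s ->
  nc ((f z - \sum_(k < N.+1) c k * (z - a) ^+ k)
      - (f w - \sum_(k < N.+1) c k * (w - a) ^+ k))
  <= 4 * M / r * (2 * s / r) ^+ N * nc (z - w).
Proof.
move=> h sr zs ws; have hc k := expands_coef_le k h; have [r0 M0 {}h] := h.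
have s0 := le_trans (normc_ge0 _) zs.
have [zr wr] : nc (z - a) < r /\ nc (w - a) < r by split; lra.
have q0 : 0 <= 2 * s / r by rewrite divr_ge0 ?mulr_ge0 // ltW.
have q2 : 2 * s / r <= 2^-1 by rewrite ler_pdivrMr //; lra.
have nzw := normc_ge0 (z - w).
apply: (@le_geo_limit _ _ (2 * M)); first exact: mulr_ge0.
move=> K.
set S := fun n x => \sum_(k < n) c k * (x - a) ^+ k.
rewrite -/(S N.+1 z) -/(S N.+1 w).
have rem x : nc (x - a) <= s -> nc (f x - S (N.+1 + K)%N x) <= M * 2^-1 ^+ K.
  move=> xs; have xr : nc (x - a) < r by lra.
  have y0 : 0 <= nc (x - a) / r by rewrite divr_ge0 ?normc_ge0 // ltW.
  have y2 : nc (x - a) / r <= 2^-1 by rewrite ler_pdivrMr //; lra.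
  apply: le_trans (h _ x xr) _; rewrite ler_wpM2l // exprD -[leRHS]mul1r.
  apply: ler_pM; rewrite ?exprn_ge0 // ?exprn_ile1 //; first lra.
  by rewrite lerXn2r ?nnegrE.
have -> : f z - S N.+1 z - (f w - S N.+1 w) =
  (S (N.+1 + K)%N z - S N.+1 z - (S (N.+1 + K)%N w - S N.+1 w))
  + ((f z - S (N.+1 + K)%N z) - (f w - S (N.+1 + K)%N w)) by ring.
apply: le_trans (normcD _ _) _; apply: lerD; last first.
  apply: le_trans (normcB _ _) _; rewrite -mulrA mulr_natl mulr2n.
  by apply: lerD; exact: rem.
have -> : S (N.+1 + K)%N z - S N.+1 z - (S (N.+1 + K)%N w - S N.+1 w) =
  \sum_(j < K) c (N + j).+1 * ((z - a) ^+ (N + j).+1 - (w - a) ^+ (N + j).+1).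
  have SD x : S (N.+1 + K)%N x - S N.+1 x = \sum_(j < K) c (N + j).+1 * (x - a) ^+ (N + j).+1.
    by rewrite /S big_split_ord /= addrAC subrr add0r.
  rewrite !SD -sumrB.
  by apply: eq_bigr => j _; rewrite mulrBr.
apply: le_trans (normc_sum _ _ _) _.
apply: (@le_trans _ _ (\sum_(j < K) 2 * M / r * (2 * s / r) ^+ N * nc (z - w) * 2^-1 ^+ j)); last first.
  rewrite -mulr_sumr mulrC.
  have -> : 4 * M / r * (2 * s / r) ^+ N * nc (z - w) =
    2 * (2 * M / r * (2 * s / r) ^+ N * nc (z - w)) by ring.
  apply: ler_wpM2r; last exact: geo_sum_le.
  by rewrite !mulr_ge0 ?exprn_ge0 // invr_ge0 ltW.
apply: ler_sum => j _; rewrite normcM.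
have hs := normc_subX_le (N + j) zs ws.
rewrite (_ : z - a - (w - a) = z - w) in hs; last by ring.
apply: le_trans (ler_pM (normc_ge0 _) (normc_ge0 _) (hc _) hs) _.
have n2 : (N + j).+1%:R <= (2 : R) ^+ (N + j).
  by rewrite -natrX ler_nat ltn_expl.
apply: (@le_trans _ _ (2 * M / r ^+ (N + j).+1 * (2 ^+ (N + j) * s ^+ (N + j) * nc (z - w)))).
  rewrite ler_wpM2l ?divr_ge0 ?mulr_ge0 ?exprn_ge0 ?(ltW r0) //.
  by rewrite !ler_wpM2r // exprn_ge0.
have -> : 2 * M / r ^+ (N + j).+1 * (2 ^+ (N + j) * s ^+ (N + j) * nc (z - w)) =
  2 * M / r * (2 * s / r) ^+ N * nc (z - w) * (2 * s / r) ^+ j.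
  have E : (2 * s / r) ^+ N * (2 * s / r) ^+ j = (2 * s) ^+ (N + j) / r ^+ (N + j).
    by rewrite -exprD expr_div_n.
  have -> : 2 * M / r * (2 * s / r) ^+ N * nc (z - w) * (2 * s / r) ^+ j =
    2 * M / r * nc (z - w) * ((2 * s / r) ^+ N * (2 * s / r) ^+ j) by ring.
  rewrite E exprMn exprSr; field.
  by rewrite expf_neq0 ?gt_eqF.
rewrite ler_wpM2l //; last by rewrite lerXn2r ?nnegrE.
by rewrite !mulr_ge0 ?exprn_ge0 // invr_ge0 ltW.
Qed.

(** The remainder of f' at z is the first Taylor coefficient at z of the remainder of f, hence is
    bounded by a Lipschitz constant of the latter near z. *)
Lemma expands_deriv f a c : expands f a c -> (\forall z \near a, holo f z) ->
  expands f^`()%classic a (fun k => k.+1%:R * c k.+1).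
Proof.
move=> hc /nearcP[r1 r10 hf].
have [r [M [hr rr1]]] : exists r M, expands_with f a c r M /\ r <= r1.
  have [r [M h]] := hc; exists (Num.min r r1), M; split; last by rewrite ge_min lexx orbT.
  have [r0 _ _] := h.
  by apply: expands_with_le h; rewrite ?lt_min ?r0 ?r10 // ge_min lexx.
have hc1 := expands_coef_le 1 hr; have [r0 M0 _] := hr.
have M0' : 0 <= 4 * M / r by rewrite divr_ge0 ?mulr_ge0 // ltW.
(* Points w with |w - z| < |z - a| lie within 2 |z - a| of a, and [expands_tail_lip] requires this
   to be at most r/4. *)
exists (r / 8), (4 * M / r); split=> //; first by rewrite divr_gt0.
move=> N z zr.
have q0 : 0 <= nc (z - a) / (r / 8) by rewrite divr_ge0 ?normc_ge0 // divr_ge0 // ltW.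
have [->|za] := eqVneq z a.
  rewrite (expands_derive1 hc) subrr Normc.normc0 mul0r; case: N => [|N].
    rewrite big_ord0 subr0 expr0 mulr1; apply: le_trans hc1 _.
    by rewrite expr1 ler_pM2r ?invr_gt0 //; lra.
  rewrite big_ord_recl expr0 !mulr1 mul1r big1 => [|k _]; last by rewrite expr0n mulr0.
  by rewrite addr0 subrr Normc.normc0 expr0n mulr0.
have u0 : 0 < nc (z - a) by rewrite normc_gt0 subr_eq0.
have [e he] : holo f z by apply: hf; clear -zr rr1 r0; lra.
have [d [hd d1]] := expands_poly c a z N.+1.
have hD := expandsB he hd.
have -> : f^`()%classic z - \sum_(k < N) k.+1%:R * c k.+1 * (z - a) ^+ k = e 1%N - d 1%N.
  rewrite (expands_derive1 he) d1 big_ord_recl mul0r mulr0 add0r; congr (_ - _).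
  by apply: eq_bigr => k _; rewrite lift0 /=; ring.
apply: (expands_coef1_le hD); apply/nearcP; exists (nc (z - a)) => // w wz.
have ws : nc (w - a) <= 2 * nc (z - a).
  by apply: le_trans (normc_triangle _ z _) _; move: wz; clear; lra.
have zs : nc (z - a) <= 2 * nc (z - a) by move: u0; clear; lra.
have sr : 2 * nc (z - a) <= r / 4 by move: zr; clear; lra.
have := expands_tail_lip N hr sr ws zs => /le_trans; apply.
rewrite (_ : 2 * (2 * nc (z - a)) / r = nc (z - a) / (r / 8) / 2); last first.
  by field; rewrite gt_eqF.
rewrite ler_wpM2r ?normc_ge0 // ler_wpM2l // lerXn2r ?nnegrE //.
- by rewrite divr_ge0.
- by move: q0; clear; lra.
Qed.

(** Each further differentiation needs holomorphy near the point and not just at it, so the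
    induction runs over all points of an open set. *)
Lemma expands_derive1n (U : set R[i]) f n a c : open U -> (forall z, U z -> holo f z) ->
  U a -> expands f a c ->
  expands f^`(n)%classic a (fun k => ((k + n) ^_ n)%:R * c (k + n)%N).
Proof.
move=> Uo hf; have h m : forall a c, U a -> expands f a c ->
    expands f^`(m)%classic a (fun k => ((k + m) ^_ m)%:R * c (k + m)%N).
  elim: m => [|m IH] {}a {}c Ua hc.
    by apply: expands_ext hc => k; rewrite addn0 ffactn0 mul1r.
  have near_holo : \forall z \near a, holo f^`(m)%classic z.
    have : \forall z \near a, U z by exact: open_nbhs_nbhs.
    by apply: nearcS => z Uz; have [c' hc'] := hf z Uz; eexists; exact: IH hc'.
  apply: expands_ext (expands_deriv (IH a c Ua hc) near_holo) => k.
  by rewrite addSnnS mulrA -natrM -[k.+1](addnK m) addSnnS mulnC -ffactnSr.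
exact: h.
Qed.

End Derivatives.

(** * The maximum principle *)

Section MaximumPrinciple.
Context {R : realType}.
Implicit Types (f g G : R[i] -> R[i]) (a z w : R[i]) (r e M : R).

Definition cis (t : R) : R[i] := cos t +i* sin t.

Lemma normc_cis t : nc (cis t) = 1.
Proof. by rewrite /= cos2Dsin2 sqrtr1. Qed.

Lemma cis_surj z : nc z = 1 -> exists2 t, 0 <= t <= 2 * pi & z = cis t.
Proof.
case: z => x y z1.
have xy : x ^+ 2 + y ^+ 2 = 1 by have := normc_sqr (x +i* y); rewrite z1 expr1n.
have x1 : -1 <= x <= 1.
  by rewrite -ler_norml; have := normc_Re (x +i* y); rewrite z1.
have cK : cos (acos x) = x by rewrite acosK // in_itv.
have sK : sin (acos x) = `|y|.
  by rewrite sin_acos // -xy addrC addKr sqrtr_sqr.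
have p0 := pi_ge0 R.
have a0 := acos_ge0 x1; have a1 := acos_lepi x1.
have [y0|y0] := lerP 0 y.
  exists (acos x); first by apply/andP; split; lra.
  by rewrite /cis cK sK ger0_norm.
exists (2 * pi - acos x); first by apply/andP; split; lra.
rewrite /cis mulr_natl cosB sinB cos2pi sin2pi cK sK ltr0_norm //.
by congr (_ +i* _); ring.
Qed.

Lemma polar z : exists2 t, 0 <= t <= 2 * pi & z = (nc z)%:C * cis t.
Proof.
have [->|z0] := eqVneq z 0.
  exists 0; last by rewrite Normc.normc0 mul0r.
  by rewrite lexx mulr_ge0 // pi_ge0.
have n0 : 0 < nc z by rewrite normc_gt0.
have nC : (nc z)%:C != 0 by apply/eqP => -[] /eqP; rewrite gt_eqF.
have [|t t01 zt] := @cis_surj (z / (nc z)%:C).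
  by rewrite normcM normc_inv normc_real gtr0_norm // divff // gt_eqF.
by exists t => //; rewrite -zt mulrC divfK.
Qed.

Definition continuous_atc (h : R[i] -> R) a : Prop :=
  forall e, 0 < e -> exists2 r, 0 < r & forall z, nc (z - a) < r -> `|h z - h a| < e.

Lemma continuous_atc_cis (h : R[i] -> R) (s t : R) : `|s| <= 1 ->
  continuous_atc h (s%:C * cis t) ->
  (fun p : R * R => h (p.1%:C * cis p.2)) @ (s, t) --> h (s%:C * cis t).
Proof.
move=> s1 hc; apply/cvgrPdist_lt => e e0; have [r r0 hr] := hc e e0.
have r3 : 0 < r / 3 by rewrite divr_gt0.
have h1 : \forall p \near (s, t), `|s - p.1| < r / 3.
  have : (fun p : R * R => p.1) @ (s, t) --> s by exact: cvg_fst.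
  by move=> /cvgrPdist_lt; apply.
have h2 : \forall p \near (s, t), `|cos t - cos p.2| < r / 3.
  have : (fun p : R * R => cos p.2) @ (s, t) --> cos t.
    by apply: continuous_cvg; [exact: continuous_cos | exact: cvg_snd].
  by move=> /cvgrPdist_lt; apply.
have h3 : \forall p \near (s, t), `|sin t - sin p.2| < r / 3.
  have : (fun p : R * R => sin p.2) @ (s, t) --> sin t.
    by apply: continuous_cvg; [exact: continuous_sin | exact: cvg_snd].
  by move=> /cvgrPdist_lt; apply.
apply: (@filterS _ (nbhs (s, t)) _ _ _ _ (filterI h1 (filterI h2 h3))).
move=> [p q] /= [k1 [k2 k3]].
rewrite distrC; apply: hr.
have -> : p%:C * cis q - s%:C * cis t =
  (p - s)%:C * cis q + s%:C * ((cos q - cos t)%:C + 'i * (sin q - sin t)%:C).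
  rewrite /cis; simpc; apply/eqP; rewrite eq_complex /=.
  by apply/andP; split; apply/eqP; ring.
apply: le_lt_trans (normcD _ _) _; rewrite !normcM !normc_real normc_cis mulr1.
have ki : nc ('i : R[i]) = 1 by rewrite /= expr0n expr1n add0r sqrtr1.
have k4 : nc ((cos q - cos t)%:C + 'i * (sin q - sin t)%:C) <= `|cos q - cos t| + `|sin q - sin t|.
  by apply: le_trans (normcD _ _) _; rewrite normcM !normc_real ki mul1r.
have k5 : `|s| * nc ((cos q - cos t)%:C + 'i * (sin q - sin t)%:C) <= `|cos q - cos t| + `|sin q - sin t|.
  apply: le_trans k4; rewrite -[leRHS]mul1r ler_wpM2r ?normc_ge0 //.
rewrite distrC in k1; rewrite distrC in k2; rewrite distrC in k3; lra.
Qed.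

(** Polar coordinates present the annulus as the image of a compact rectangle. The case s1 = 0, s2 =
    1 is the closed disk, the case s1 = s2 = 1 the circle. *)
Lemma annulus_EVT_max (h : R[i] -> R) (s1 s2 : R) : 0 <= s1 -> s1 <= s2 -> s2 <= 1 ->
  (forall a, s1 <= nc a <= s2 -> continuous_atc h a) ->
  exists2 c, s1 <= nc c <= s2 & forall z, s1 <= nc z <= s2 -> h z <= h c.
Proof.
move=> s10 s12 s21 hc.
pose A : set (R * R) := `[s1, s2] `*` `[0, 2 * pi].
pose F := fun p : R * R => h (p.1%:C * cis p.2).
have nE s t : 0 <= s -> nc (s%:C * cis t) = s.
  by move=> s0; rewrite normcM normc_cis mulr1 normc_real ger0_norm.
have A0 : A !=set0.
  exists (s1, 0); split; rewrite /= in_itv /= lexx //=.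
  by rewrite mulr_ge0 // pi_ge0.
have cA : compact A by apply: compact_setX; exact: segment_compact.
have cF : {within A, continuous F}.
  apply: continuous_in_subspaceT => -[s t]; rewrite inE => -[/=].
  rewrite in_itv /= => /andP[ss1 ss2] _.
  apply: continuous_atc_cis; first by rewrite ger0_norm; lra.
  by apply: hc; rewrite nE ?ss1 //; lra.
have [[s t]] := compact_EVT_max A0 cA cF.
rewrite inE => -[/=]; rewrite in_itv /= => ss _ hmax.
have s0 : 0 <= s by case/andP: ss; lra.
exists (s%:C * cis t); first by rewrite nE.
move=> z zs; have [t' t'01 zt] := polar z.
have := hmax (nc z, t'); rewrite inE /F /= -zt; apply.
by split; rewrite /= in_itv.
Qed.

(** Order two is what the test against e |z|^2 requires, and the 2-jet of a quotient can be written
    down explicitly ([jet2_div]). *)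
Definition jet2 f a : Prop := exists c0 c1 c2 : R[i], exists r M : R,
  [/\ 0 < r, 0 <= M & forall z, nc (z - a) < r ->
    nc (f z - (c0 + c1 * (z - a) + c2 * (z - a) ^+ 2)) <= M * nc (z - a) ^+ 3].

Lemma normc_parallelogram a u : nc (a + u) ^+ 2 + nc (a - u) ^+ 2 = 2 * nc a ^+ 2 + 2 * nc u ^+ 2.
Proof. by case: a u => [a1 a2] [u1 u2]; rewrite !normc_sqr /=; ring. Qed.

(* Averaging f over a + u and a - u kills the linear term of the jet; the
   direction of u aligns the quadratic term with f a, so that e |z|^2 wins. *)
Lemma jet2_no_local_max f a e : 0 < e -> jet2 f a ->
  (\forall z \near a, nc (f z) + e * nc z ^+ 2 <= nc (f a) + e * nc a ^+ 2) -> False.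
Proof.
move=> e0 [c0 [c1 [c2 [r [M [r0 M0 hf]]]]]] /nearcP[r1 r10 hmax].
have fa : f a = c0.
  have := hf a; rewrite subrr Normc.normc0 => /(_ r0).
  rewrite !expr0n /= !mulr0 !addr0 => h; apply/eqP.
  by rewrite -subr_eq0 -normc_eq0 eq_le normc_ge0 h.
have [v v1 hv] : exists2 v : R[i], nc v = 1 &
    forall s : R, nc c0 <= nc (c0 + c2 * (s%:C * v) ^+ 2).
  have [c00|c00] := eqVneq c0 0.
    by exists 1 => [|s]; rewrite ?Normc.normc1 // c00 Normc.normc0 normc_ge0.
  have [c20|c20] := eqVneq c2 0.
    by exists 1 => [|s]; rewrite ?Normc.normc1 // c20 mul0r addr0.
  have n0 : 0 < nc c0 by rewrite normc_gt0.
  have n2 : 0 < nc c2 by rewrite normc_gt0.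
  have n2' : (nc c2)%:C != 0 by apply/eqP => -[] /eqP; rewrite gt_eqF.
  pose w := c0 * c2^* / (nc c0 * nc c2)%:C.
  pose v := sqrtc w.
  have v2 : v ^+ 2 = w by exact: sqr_sqrtc.
  have w1 : nc w = 1.
    rewrite /w !normcM normc_conj normc_inv normc_real gtr0_norm ?mulr_gt0 //.
    by rewrite divff // gt_eqF // mulr_gt0.
  exists v => [|s].
    by apply/eqP; rewrite -(@eqrXn2 _ 2) ?normc_ge0 // -normcX v2 w1 expr1n.
  have -> : c0 + c2 * (s%:C * v) ^+ 2 = c0 * (1 + s ^+ 2 * nc c2 / nc c0)%:C.
    rewrite exprMn v2 /w.
    have -> : c2 * (s%:C ^+ 2 * (c0 * c2^* / (nc c0 * nc c2)%:C)) =
       s%:C ^+ 2 * c0 * (c2 * c2^*) / (nc c0 * nc c2)%:C by ring.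
    rewrite mulcJ_normc rmorphD rmorph1 mulrDr mulr1; congr (_ + _).
    set X := (nc c2 ^+ 2)%:C; set Y := (nc c0 * nc c2)%:C.
    have -> : s%:C ^+ 2 * c0 * X / Y = c0 * (s%:C ^+ 2 * X / Y) by ring.
    congr (_ * _); rewrite /X /Y -fmorphV -rmorphXn -!rmorphM /=; congr (_%:C).
    by field; rewrite !gt_eqF.
  have X0 : 0 <= s ^+ 2 * nc c2 / nc c0.
    by apply: divr_ge0; last exact: ltW; apply: mulr_ge0; [exact: sqr_ge0 | exact: ltW].
  rewrite normcM normc_real ger0_norm; last by rewrite addr_ge0.
  by rewrite ler_peMr ?normc_ge0 // lerDl.
pose s := Num.min (Num.min (r / 2) (r1 / 2)) (e / (2 * (M + 1))).
have s0 : 0 < s by rewrite !lt_min !divr_gt0 ?mulr_gt0 //; lra.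
have sr : s < r by apply: (@le_lt_trans _ _ (r / 2)); [rewrite !ge_min lexx | lra].
have sr1 : s < r1 by apply: (@le_lt_trans _ _ (r1 / 2)); [rewrite !ge_min lexx orbT | lra].
have se : M * s < e.
  have : s <= e / (2 * (M + 1)) by rewrite !ge_min lexx !orbT.
  by rewrite ler_pdivlMr; [nra | lra].
set u := s%:C * v.
have us : nc u = s by rewrite normcM normc_real v1 mulr1 gtr0_norm.
have up : a + u - a = u by rewrite addrC addKr.
have um : a - u - a = - u by rewrite addrC addKr.
have h1 := hf (a + u); rewrite up us in h1; have {}h1 := h1 sr.
have h2 := hf (a - u); rewrite um normcN us in h2; have {}h2 := h2 sr.
have k1 := hmax (a + u); rewrite up us in k1; have {}k1 := k1 sr1.
have k2 := hmax (a - u); rewrite um normcN us in k2; have {}k2 := k2 sr1.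
have par := normc_parallelogram a u; rewrite us in par.
have h3 : 2 * nc c0 <= nc (f (a + u)) + nc (f (a - u)) + 2 * (M * s ^+ 3).
  have -> : 2 * nc c0 = nc c0 + nc c0 by ring.
  have h := lerD (hv s) (hv s); apply: le_trans h _; rewrite -/u.
  set q := c0 + c2 * u ^+ 2.
  have -> : nc q + nc q = nc (q + q).
    rewrite -mulr2n -[q + q]mulr2n normcMn //.
  have -> : q + q = f (a + u) + f (a - u) -
    ((f (a + u) - (c0 + c1 * u + c2 * u ^+ 2)) +
     (f (a - u) - (c0 + c1 * - u + c2 * (- u) ^+ 2))) by rewrite /q; ring.
  apply: le_trans (normcB _ _) _; apply: lerD; first exact: normcD.
  by apply: le_trans (normcD _ _) _; rewrite [leRHS](mulr_natl _ 2) mulr2n lerD.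
rewrite fa in k1 k2.
have s3 : s ^+ 3 = s ^+ 2 * s by rewrite exprSr.
have s2 : 0 < s ^+ 2 by rewrite exprn_gt0.
have : e * s ^+ 2 <= M * s * s ^+ 2.
  have -> : M * s * s ^+ 2 = M * s ^+ 3 by rewrite s3; ring.
  have : e * (nc (a + u) ^+ 2 + nc (a - u) ^+ 2) = e * (2 * nc a ^+ 2 + 2 * s ^+ 2).
    by rewrite par.
  clear -h3 k1 k2; rewrite mulrDr mulrDr => E; lra.
by rewrite ler_pM2r // leNgt se.
Qed.

Lemma jet2_cts f a : jet2 f a -> continuous_atc (fun z => nc (f z)) a.
Proof.
move=> [c0 [c1 [c2 [r [M [r0 M0 hf]]]]]] e e0.
have fa : f a = c0.
  have := hf a; rewrite subrr Normc.normc0 => /(_ r0).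
  rewrite !expr0n /= !mulr0 !addr0 => h; apply/eqP.
  by rewrite -subr_eq0 -normc_eq0 eq_le normc_ge0 h.
pose C := M + nc c1 + nc c2.
have n1 := normc_ge0 c1; have n2 := normc_ge0 c2.
have C0 : 0 <= C by rewrite /C; lra.
exists (Num.min (Num.min r 1) (e / (C + 1))).
  by rewrite !lt_min r0 ltr01 divr_gt0 //; lra.
move=> z; rewrite !lt_min -andbA => /and3P[zr z1].
rewrite ltr_pdivlMr; last lra.
move=> ze; have nz := normc_ge0 (z - a).
have h := hf z zr.
have zz : nc (z - a) ^+ 2 <= nc (z - a) by rewrite expr2 ler_piMr // ltW.
suff : nc (f z - f a) <= C * nc (z - a).
  move=> hh; apply: (@le_lt_trans _ _ (nc (f z - f a))); last by nra.
  rewrite ler_norml; have := normc_sub_le (f z) (f a); have := normc_sub_le (f a) (f z).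
  by rewrite normc_distC => *; apply/andP; split; lra.
rewrite fa.
have -> : f z - c0 = (f z - (c0 + c1 * (z - a) + c2 * (z - a) ^+ 2)) +
   (c1 * (z - a) + c2 * (z - a) ^+ 2) by ring.
apply: le_trans (normcD _ _) _.
have h' := normcD (c1 * (z - a)) (c2 * (z - a) ^+ 2).
rewrite (normcM c1) (normcM c2) normcX in h'.
have z3 : nc (z - a) ^+ 3 <= nc (z - a) by rewrite exprS; nra.
by rewrite /C; nra.
Qed.

Lemma max_principle f (L : R) : (forall a, nc a <= 1 -> jet2 f a) ->
  (forall a, nc a = 1 -> nc (f a) <= L) -> forall z, nc z <= 1 -> nc (f z) <= L.
Proof.
move=> jf fT z z1; rewrite leNgt; apply/negP => Lz.
(* With this e a maximum of |f| + e |.|^2 on the circle would give |f z| <= L + e < |f z|; so the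
   maximum is interior, which [jet2_no_local_max] excludes. *)
pose e := (nc (f z) - L) / 2.
have e0 : 0 < e by rewrite divr_gt0 // subr_gt0.
pose h w := nc (f w) + e * nc w ^+ 2.
have [|||a ha|c c1 hc] := @annulus_EVT_max h 0 1 => //.
  move=> d d0; have d2 : 0 < d / 2 by rewrite divr_gt0.
  have [|r r0 hr] := jet2_cts (jf a _) d2; first by case/andP: ha.
  exists (Num.min (Num.min r 1) (d / (6 * (e + 1)))).
    by rewrite !lt_min r0 ltr01 divr_gt0 ?mulr_gt0 //; lra.
  move=> w; rewrite !lt_min -andbA => /and3P[/hr wr w1].
  rewrite ltr_pdivlMr; last lra.
  move=> wd; have nw := normc_ge0 (w - a).
  have na : 0 <= nc a <= 1 by [].
  have t1 := normc_sub_le w a; have t2 := normc_sub_le a w; rewrite normc_distC in t2.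
  have sq : `|nc w ^+ 2 - nc a ^+ 2| <= 3 * nc (w - a).
    rewrite subr_sqr normrM mulrC; apply: ler_pM => //.
      by rewrite ger0_norm ?addr_ge0 ?normc_ge0 //; case/andP: na; lra.
    by rewrite ler_norml; apply/andP; split; lra.
  have -> : h w - h a = (nc (f w) - nc (f a)) + e * (nc w ^+ 2 - nc a ^+ 2).
    by rewrite /h; ring.
  apply: le_lt_trans (ler_normD _ _) _; rewrite normrM (gtr0_norm e0).
  have : e * `|nc w ^+ 2 - nc a ^+ 2| <= e * (3 * nc (w - a)) by rewrite ler_wpM2l // ltW.
  have : e * (3 * nc (w - a)) <= d / 2 by nra.
  by move: wr; lra.
have c1' : nc c <= 1 by case/andP: c1.
have hz : h z <= h c by apply: hc; rewrite normc_ge0.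
have [cT|cD] : nc c = 1 \/ nc c < 1 by move: c1'; rewrite le_eqVlt => /orP[/eqP|]; auto.
  move: hz; rewrite /h cT expr1n mulr1 => hz.
  have := fT c cT; have : 0 <= e * nc z ^+ 2 by rewrite mulr_ge0 ?exprn_ge0 ?normc_ge0 // ltW.
  by move: Lz hz; rewrite /e; lra.
apply: (@jet2_no_local_max f c e) => //; first exact: jf.
apply/nearcP; exists (1 - nc c); first by rewrite subr_gt0.
move=> w wc; apply: hc; rewrite normc_ge0 /=.
have := normc_sub_le w c; lra.
Qed.

Lemma jet2_div f g a : holo f a -> holo g a -> g a != 0 -> jet2 (fun z => f z / g z) a.
Proof.
move=> [c hc] [d hd] ga.
have d0 : d 0%N != 0 by rewrite -(expands_val hd).
(* e0, e1, e2 are the Taylor coefficients of 1/g, obtained by solving g E = 1 up to order three;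
   then f/g - f E = - (f/g) (g E - 1) is of third order. *)
pose e0 := (d 0%N)^-1; pose e1 := - (d 1%N) * e0 / d 0%N.
pose e2 := - (d 1%N * e1 + d 2%N * e0) / d 0%N.
pose E z := e0 + (z - a) * (e1 + (z - a) * e2).
have [ec [he e_0 e_1 e_2]] : exists ec,
    [/\ expands E a ec, ec 0%N = e0, ec 1%N = e1 & ec 2%N = e2].
  eexists; split.
    apply: expandsD (expands_cst e0 a) (expands_mulX (expandsD (expands_cst e1 a)
      (expands_mulX (expands_cst e2 a)))).
  - by rewrite /= addr0.
  - by rewrite /= addr0 add0r.
  - by rewrite /= !add0r.
have hP := expandsM hc he; have hH := expandsM hd he.
set p := convol c ec in hP; set h := convol d ec in hH.
have h0 : h 0%N = 1 by rewrite /h /convol big_ord1 e_0 /e0 divff.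
have h1 : h 1%N = 0.
  by rewrite /h /convol !big_ord_recl big_ord0 /= subn0 subnn e_0 e_1 /e1 /e0; field.
have h2 : h 2%N = 0.
  rewrite /h /convol !big_ord_recl big_ord0 /= subn0 e_2.
  rewrite (_ : (2 - bump 0 0)%N = 1%N) // (_ : (2 - _)%N = 0%N) // e_0 e_1 /e2.
  rewrite (_ : bump 0 (bump 0 0) = 2%N) // (_ : bump 0 0 = 1%N) //.
  by field.
have [r1 [M1 [k1 k2]]] := expands_common hP hH.
have [r2 [M2 k3]] := hc.
have n0 : 0 < nc (g a) / 2 by rewrite divr_gt0 // normc_gt0.
have [r3 r30 k4] := holo_cts (ex_intro _ d hd) n0.
have [r10 M10 {}k1] := k1; have [_ _ {}k2] := k2; have [r20 M20 {}k3] := k3.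
exists (p 0%N), (p 1%N), (p 2%N), (Num.min (Num.min r1 r2) r3),
  (M1 / r1 ^+ 3 + M2 / (nc (g a) / 2) * (M1 / r1 ^+ 3)).
have q0 : 0 <= M1 / r1 ^+ 3 by rewrite divr_ge0 // exprn_ge0 // ltW.
have q1 : 0 <= M2 / (nc (g a) / 2) by rewrite divr_ge0 // ltW.
split; first by rewrite !lt_min r10 r20.
  by rewrite addr_ge0 // mulr_ge0.
move=> z; rewrite !lt_min -andbA => /and3P[z1 z2 z3].
have gz : nc (g a) / 2 <= nc (g z).
  have := k4 z z3; have := normc_sub_le (g a) (g z); rewrite normc_distC; lra.
have gz0 : g z != 0 by rewrite -normc_gt0; lra.
have {}k1 := k1 3%N z z1; have {}k2 := k2 3%N z z1.
have {}k3 := k3 0%N z z2; rewrite big_ord0 subr0 expr0 mulr1 in k3.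
rewrite !big_ord_recl big_ord0 /= expr0 mulr1 addr0 expr1 in k1.
rewrite (_ : bump 0 (bump 0 0) = 2%N) // (_ : bump 0 0 = 1%N) // in k1.
rewrite !big_ord_recl big_ord0 /= expr0 mulr1 addr0 expr1 in k2.
rewrite (_ : bump 0 (bump 0 0) = 2%N) // (_ : bump 0 0 = 1%N) // in k2.
rewrite h0 h1 h2 !mul0r !addr0 in k2.
have -> : f z / g z - (p 0%N + p 1%N * (z - a) + p 2%N * (z - a) ^+ 2) =
  (f z * E z - (p 0%N + (p 1%N * (z - a) + p 2%N * (z - a) ^+ 2)))
  - (f z / g z) * (g z * E z - 1) by field.
apply: le_trans (normcB _ _) _; rewrite mulrDl.
have r3E : M1 * (nc (z - a) / r1) ^+ 3 = M1 / r1 ^+ 3 * nc (z - a) ^+ 3.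
  by rewrite expr_div_n; ring.
rewrite r3E in k1 k2.
apply: lerD => //; rewrite normcM -mulrA; apply: ler_pM; rewrite ?normc_ge0 //.
rewrite normcM normc_inv; apply: ler_pM; rewrite ?normc_ge0 ?invr_ge0 ?normc_ge0 //.
by rewrite lef_pV2 // posrE normc_gt0.
Qed.

Lemma max_principle_ratio f g : (forall a, nc a <= 1 -> holo f a) ->
  (forall a, nc a <= 1 -> holo g a) -> (forall a, nc a <= 1 -> g a != 0) ->
  (forall a, nc a = 1 -> nc (f a) <= nc (g a)) ->
  forall z, nc z <= 1 -> nc (f z) <= nc (g z).
Proof.
move=> hf hg g0 fg z z1.
have := @max_principle (fun z => f z / g z) 1 _ _ z z1.
rewrite normcM normc_inv ler_pdivrMr ?normc_gt0 ?g0 // mul1r; apply.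
  by move=> a a1; apply: jet2_div; [exact: hf | exact: hg | exact: g0].
move=> a a1; rewrite normcM normc_inv ler_pdivrMr ?mul1r ?fg // normc_gt0.
by rewrite g0 // a1.
Qed.

Lemma holo_max_principle f (L : R) : (forall a, nc a <= 1 -> holo f a) ->
  (forall a, nc a = 1 -> nc (f a) <= L) -> forall z, nc z <= 1 -> nc (f z) <= L.
Proof.
move=> hf; apply: max_principle => a a1.
have := jet2_div (hf a a1) (holo_cst 1 a) (oner_neq0 _).
by rewrite (_ : (fun z => _) = f) //; apply/funext => z; rewrite divr1.
Qed.

End MaximumPrinciple.

(** * Dyadic sums of a regular majorant *)

Section MajorantSums.
Context {R : realType}.
Implicit Types (w f : R -> R) (d C : R).
Local Notation mu := (@lebesgue_measure R).

(** One step of the dyadic lower bounds below: an interval on which the integrand is at least b is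
    split off. [D] may exceed the union of the two pieces, for instance by their common endpoint. *)
Lemma integral_split_ge (A D : set R) (x y b : R) (f : R -> R) :
  measurable A -> measurable D -> A `<=` D -> `]x, y[ `<=` D -> x < y ->
  (forall t, A t -> x < t < y -> False) ->
  measurable_fun D f -> (forall t, D t -> 0 <= f t) ->
  0 <= b -> (forall t, x < t < y -> b <= f t) ->
  (\int[mu]_(t in A) (f t)%:E + (b * (y - x))%:E <= \int[mu]_(t in D) (f t)%:E)%E.
Proof.
move=> mA mD AD xyD xy dis mf f0 b0 bf.
have mB : measurable (`]x, y[ : set R) by exact: measurable_itv.
have ABD : A `|` `]x, y[ `<=` D by move=> t [/AD|/xyD].
have f0e t : D t -> (0 <= (f t)%:E)%E by move=> Dt; rewrite lee_fin f0.
have mfe (E : set R) : E `<=` D -> measurable_fun E (fun t => (f t)%:E).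
  by move=> ED; apply/measurable_EFinP; exact: measurable_funS mf.
apply: (@le_trans _ _ (\int[mu]_(t in A `|` `]x, y[) (f t)%:E)%E); last first.
  apply: ge0_subset_integral => //; first exact: measurableU.
  exact: mfe.
rewrite ge0_integral_setU //; last 3 first.
- exact: mfe.
- by move=> t /ABD/f0e.
- rewrite disj_set2E; apply/eqP; rewrite -subset0 => t [At].
  by rewrite /= in_itv /= => /(dis t At).
rewrite leeD2l //.
have -> : (b * (y - x))%:E = (\int[mu]_(t in `]x, y[) (cst b%:E) t)%E.
  have E : mu (`]x, y[%classic : set R) = (y - x)%:E.
    by rewrite lebesgue_measure_itv /= lte_fin xy EFinB.
  have := integral_cst mu mB b%:E; rewrite [X in _ = (_ * X)%E]E => ->.
  by rewrite EFinM.
apply: ge0_le_integral => //.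
- exact: mfe.
Qed.

Lemma majorant_ge0 w d : majorant w -> 0 < d -> 0 <= w d.
Proof. by move=> [wp _ _ _ _] d0; rewrite ltW ?wp. Qed.

Lemma majorant_le w (s t : R) : majorant w -> 0 < s -> s <= t -> w s <= w t.
Proof.
move=> [_ h _ _ _] s0 st; apply: h => //; rewrite in_itv /= andbT //.
exact: lt_le_trans st.
Qed.

Lemma majorant_div_le w (s t : R) : majorant w -> 0 < s -> s <= t -> w t / t <= w s / s.
Proof.
move=> [_ _ _ _ h] s0 st; apply: h => //; rewrite in_itv /= andbT //.
exact: lt_le_trans st.
Qed.

Lemma majorant_double w d : majorant w -> 0 < d -> w (2 * d) <= 2 * w d.
Proof.
move=> hw d0; have dd : d <= 2 * d by lra.
have := majorant_div_le hw d0 dd; rewrite ler_pdivrMr ?mulr_gt0 // => h; apply: le_trans h _.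
by rewrite [leRHS](_ : _ = w d / d * (2 * d)) //; field; rewrite gt_eqF.
Qed.

Lemma majorant_measurable w n : majorant w ->
  measurable_fun (`]0, +oo[ : set R) (fun t => w t / t ^+ n).
Proof.
move=> [_ _ cw _ _].
apply: open_continuous_measurable_fun; first exact: interval_open.
move=> t; rewrite inE /= in_itv /= andbT => t0.
apply: cvgM; first by apply: cw; rewrite in_itv /= andbT.
by apply: cvgV; [rewrite expf_neq0 // gt_eqF | exact: exprn_continuous].
Qed.

(** On ]d/2, d[ the integrand w(t)/t is at least w(d)/d, so each dyadic piece contributes at least
    w(d)/2; hence the factor 2. *)
Lemma regular_sum_small w C : majorant w ->
  (forall d, 0 < d -> d < 2 ->
    (\int[mu]_(t in `]0%R, d[) (w t / t)%:E +
     d%:E * \int[mu]_(t in `]d, +oo[) (w t / t ^+ 2)%:E <= (C * w d)%:E)%E) ->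
  forall d K, 0 < d -> d < 2 -> \sum_(k < K) w (d / 2 ^+ k) <= 2 * C * w d.
Proof.
move=> hw hC d K d0 d2.
have mw d' : measurable_fun (`]0, d'[ : set R) (fun t => w t / t).
  apply: measurable_funS (majorant_measurable 1 hw) => //.
  by move=> t; rewrite /= !in_itv /= andbT => /andP[].
have wp d' t : (`]0, d'[%classic : set R) t -> 0 <= w t / t.
  rewrite /= in_itv /= => /andP[t0 _].
  by rewrite divr_ge0 ?(majorant_ge0 hw) // ltW.
have low : forall K d, 0 < d ->
    ((\sum_(k < K) w (d / 2 ^+ k) / 2)%:E <= \int[mu]_(t in `]0%R, d[) (w t / t)%:E)%E.
  clear K d d0 d2; elim=> [|K IH] d d0.
    by rewrite big_ord0; apply: integral_ge0 => t ht; rewrite lee_fin (wp _ _ ht).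
  have h2 : 0 < d / 2 by rewrite divr_gt0.
  have dd : d / 2 < d by lra.
  have := @integral_split_ge `]0, (d / 2)[ `]0, d[ (d / 2) d (w d / d) (fun t => w t / t).
  move=> /(_ (measurable_itv _) (measurable_itv _)) h.
  apply: le_trans (h _ _ dd _ (mw d) (wp d) _ _); last 5 first.
  - by move=> t; rewrite /= !in_itv /= => /andP[-> ?]; lra.
  - by move=> t; rewrite /= !in_itv /= => /andP[? ->]; rewrite andbT; lra.
  - by move=> t; rewrite /= in_itv /= => /andP[_ t1] /andP[t2 _]; lra.
  - by rewrite divr_ge0 ?(majorant_ge0 hw) // ltW.
  - by move=> t /andP[t1 t2]; apply: majorant_div_le => //; lra.
  rewrite big_ord_recl expr0 divr1 addrC EFinD; apply: leeD; last first.
    by rewrite lee_fin [leRHS](_ : _ = w d / 2) //; field; rewrite gt_eqF.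
  apply: le_trans (IH _ h2); rewrite lee_fin le_eqVlt; apply/orP; left; apply/eqP.
  by apply: eq_bigr => k _; rewrite lift0 exprS invfM mulrA.
have I := low K d d0.
have J : (0 <= d%:E * \int[mu]_(t in `]d, +oo[) (w t / t ^+ 2)%:E)%E.
  apply: mule_ge0; first by rewrite lee_fin ltW.
  apply: integral_ge0 => t; rewrite /= in_itv /= andbT => dt.
  have t0 : 0 < t by exact: lt_trans dt.
  by rewrite lee_fin divr_ge0 ?exprn_ge0 ?(majorant_ge0 hw) // ltW.
have := le_trans (leeD I J) (hC d d0 d2); rewrite adde0 lee_fin -mulr_suml.
by rewrite ler_pdivrMr // => h; apply: le_trans h _; rewrite mulrC mulrA.
Qed.

(** On ]d, 2d[ the integrand is at least w(d)/(2d)^2, so each dyadic piece contributes at least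
    w(d)/(4d); hence the factor 4. *)
Lemma regular_sum_large w C : majorant w ->
  (forall d, 0 < d -> d < 2 ->
    (\int[mu]_(t in `]0%R, d[) (w t / t)%:E +
     d%:E * \int[mu]_(t in `]d, +oo[) (w t / t ^+ 2)%:E <= (C * w d)%:E)%E) ->
  forall d K, 0 < d -> d < 2 -> \sum_(k < K) w (2 ^+ k * d) / 2 ^+ k <= 4 * C * w d.
Proof.
move=> hw hC d K d0 d2.
have mw d' : 0 < d' -> measurable_fun (`]d', +oo[ : set R) (fun t => w t / t ^+ 2).
  move=> d'0; apply: measurable_funS (majorant_measurable 2 hw) => //.
  by move=> t; rewrite /= !in_itv /= !andbT; exact: lt_trans.
have wp d' t : 0 < d' -> (`]d', +oo[%classic : set R) t -> 0 <= w t / t ^+ 2.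
  move=> d'0; rewrite /= in_itv /= andbT => dt; have t0 := lt_trans d'0 dt.
  by rewrite divr_ge0 ?exprn_ge0 ?(majorant_ge0 hw) // ltW.
have low : forall K d, 0 < d ->
    ((\sum_(k < K) w (2 ^+ k * d) / (4 * (2 ^+ k * d)))%:E <=
      \int[mu]_(t in `]d, +oo[) (w t / t ^+ 2)%:E)%E.
  clear K d d0 d2; elim=> [|K IH] d d0.
    by rewrite big_ord0; apply: integral_ge0 => t ht; rewrite lee_fin (wp d).
  have h2 : 0 < 2 * d by rewrite mulr_gt0.
  have dd : d < 2 * d by lra.
  have := @integral_split_ge `](2 * d), +oo[ `]d, +oo[ d (2 * d) (w d / (2 * d) ^+ 2) (fun t => w t / t ^+ 2).
  move=> /(_ (measurable_itv _) (measurable_itv _)) h.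
  apply: le_trans (h _ _ dd _ (mw d d0) (fun t => wp d t d0) _ _); last 5 first.
  - by move=> t; rewrite /= !in_itv /= !andbT => ?; lra.
  - by move=> t; rewrite /= !in_itv /= => /andP[-> _].
  - by move=> t; rewrite /= in_itv /= andbT => t1 /andP[_ t2]; lra.
  - by rewrite divr_ge0 ?exprn_ge0 ?(majorant_ge0 hw) // ltW.
  - move=> t /andP[t1 t2]; have t0 := lt_trans d0 t1.
    apply: ler_pM; rewrite ?invr_ge0 ?exprn_ge0 ?(majorant_ge0 hw) ?(ltW h2) //.
      by apply: (majorant_le hw) => //; exact: ltW.
    rewrite lef_pV2 ?posrE ?exprn_gt0 //.
    by apply: lerXn2r; rewrite ?nnegrE ltW.
  rewrite big_ord_recl expr0 mul1r addrC EFinD; apply: leeD; last first.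
    by rewrite lee_fin [leRHS](_ : _ = w d / (4 * d)) //; field; rewrite gt_eqF.
  apply: le_trans (IH _ h2); rewrite lee_fin le_eqVlt; apply/orP; left; apply/eqP.
  by apply: eq_bigr => k _; rewrite lift0 exprSr -mulrA.
have J : (0 <= \int[mu]_(t in `]0%R, d[) (w t / t)%:E)%E.
  apply: integral_ge0 => t; rewrite /= in_itv /= => /andP[t0 _].
  by rewrite lee_fin divr_ge0 ?(majorant_ge0 hw) // ltW.
have I : ((d * \sum_(k < K) w (2 ^+ k * d) / (4 * (2 ^+ k * d)))%:E <=
    d%:E * \int[mu]_(t in `]d, +oo[) (w t / t ^+ 2)%:E)%E.
  by rewrite EFinM lee_pmul2l ?lte_fin // low.
have := le_trans (leeD J I) (hC d d0 d2); rewrite add0e lee_fin.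
have -> : d * \sum_(k < K) w (2 ^+ k * d) / (4 * (2 ^+ k * d)) =
   (\sum_(k < K) w (2 ^+ k * d) / 2 ^+ k) / 4.
  rewrite mulr_sumr mulr_suml; apply: eq_bigr => k _; field.
  by rewrite expf_neq0 // gt_eqF.
by rewrite ler_pdivrMr // => h; apply: le_trans h _; rewrite mulrC mulrA.
Qed.

End MajorantSums.

(** * Finite Blaschke products and their boundary behaviour *)

Section InnerFactors.
Context {R : realType}.
Implicit Types (f g B : R[i] -> R[i]) (a z w : R[i]).

(* The last clause is a Schwarz-Pick estimate at distance at most half the
   distance to the circle, in a form that is stable under products. *)
Definition inner_like B : Prop :=
  [/\ forall z, nc z <= 1 -> holo B z,
      forall z, nc z <= 1 -> nc (B z) <= 1,
      forall z, nc z = 1 -> nc (B z) = 1 &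
      forall z w, nc z < 1 -> nc w < 1 -> nc (z - w) <= (1 - nc w) / 2 ->
        nc (B z - B w) <= 4 * (1 - nc (B w)) * (nc (z - w) / (1 - nc w))].

Lemma inner_like_near B1 B2 : (forall z, B1 z = B2 z) -> inner_like B1 -> inner_like B2.
Proof. by move=> /funext ->. Qed.

Lemma inner_like1 : inner_like (fun=> 1).
Proof.
split=> [z _|z _|z _|z w z1 w1 _]; rewrite ?Normc.normc1 ?subrr ?mulr0 ?mul0r ?Normc.normc0 //.
exact: holo_cst.
Qed.

Lemma inner_likeM B1 B2 : inner_like B1 -> inner_like B2 ->
  inner_like (fun z => B1 z * B2 z).
Proof.
move=> [h1 b1 t1 s1] [h2 b2 t2 s2]; split.
- by move=> z z1; apply: holoM; [exact: h1 | exact: h2].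
- by move=> z z1; rewrite normcM mulr_ile1 ?normc_ge0 ?b1 ?b2.
- by move=> z z1; rewrite normcM t1 // t2 // mulr1.
move=> z w z1 w1 zw.
have -> : B1 z * B2 z - B1 w * B2 w = B1 z * (B2 z - B2 w) + B2 w * (B1 z - B1 w) by ring.
apply: le_trans (normcD _ _) _; rewrite !normcM.
have k1 := s1 z w z1 w1 zw; have k2 := s2 z w z1 w1 zw.
have bz := b1 z (ltW z1); have bw := b2 w (ltW w1).
set q := nc (z - w) / (1 - nc w) in k1 k2 *.
(* 1 - b1 b2 = (1 - b2) + b2 (1 - b1) matches the product rule for differences term by term, so the
   constant 4 does not grow with the number of factors. *)
have -> : 4 * (1 - nc (B1 w) * nc (B2 w)) * q =
  4 * (1 - nc (B2 w)) * q + nc (B2 w) * (4 * (1 - nc (B1 w)) * q) by ring.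
apply: lerD; last by rewrite ler_wpM2l ?normc_ge0.
apply: le_trans k2; rewrite -[leRHS]mul1r ler_wpM2r ?normc_ge0 //.
Qed.

Lemma inner_likeX B m : inner_like B -> inner_like (fun z => B z ^+ m).
Proof.
move=> hB; elim: m => [|m IH]; first exact: inner_like_near inner_like1.
by apply: inner_like_near (inner_likeM hB IH) => z; rewrite exprS.
Qed.

Lemma inner_like_prod (I : eqType) (s : seq I) (F : I -> R[i] -> R[i]) :
  (forall i, i \in s -> inner_like (F i)) -> inner_like (fun z => \prod_(i <- s) F i z).
Proof.
elim: s => [|i s IH] hF.
  by apply: inner_like_near inner_like1 => z; rewrite big_nil.
have h1 : inner_like (F i) by apply: hF; rewrite inE eqxx.
have h2 : inner_like (fun z => \prod_(j <- s) F j z).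
  by apply: IH => j js; apply: hF; rewrite inE js orbT.
by apply: inner_like_near (inner_likeM h1 h2) => z; rewrite big_cons.
Qed.

Definition blaschke_factor a z : R[i] := (z - a) / (1 - a^* * z).

Lemma blaschke_den a z : nc a < 1 -> nc z <= 1 -> 1 - nc z <= nc (1 - a^* * z) /\
  1 - a^* * z != 0.
Proof.
move=> a1 z1; have h := normc_sub_le 1 (a^* * z).
rewrite Normc.normc1 normcM normc_conj in h.
have na := normc_ge0 a; have nz := normc_ge0 z.
have az : nc a * nc z <= nc z by rewrite ler_piMl // ltW.
split; first lra.
rewrite -normc_gt0; have : nc a * nc z < 1 by nra.
lra.
Qed.

Lemma blaschke_factor_sqr a z : nc a < 1 -> nc z <= 1 ->
  1 - nc (blaschke_factor a z) ^+ 2 =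
  (1 - nc a ^+ 2) * (1 - nc z ^+ 2) / nc (1 - a^* * z) ^+ 2.
Proof.
move=> a1 z1; have [_ d0] := blaschke_den a1 z1.
have n0 : nc (1 - a^* * z) ^+ 2 != 0 by rewrite expf_neq0 // normc_eq0.
rewrite /blaschke_factor normcM normc_inv exprMn exprVn.
have E : nc (1 - a^* * z) ^+ 2 - nc (z - a) ^+ 2 = (1 - nc a ^+ 2) * (1 - nc z ^+ 2).
  by rewrite !normc_sqr; case: (a) (z) => [a1' a2] [z1' z2] /=; ring.
by rewrite -E mulrBl divff.
Qed.

Lemma blaschke_factor_sub a z w : nc a < 1 -> nc z <= 1 -> nc w <= 1 ->
  blaschke_factor a z - blaschke_factor a w =
  (1 - a * a^*) * (z - w) / ((1 - a^* * z) * (1 - a^* * w)).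
Proof.
move=> a1 z1 w1; have [_ dz] := blaschke_den a1 z1; have [_ dw] := blaschke_den a1 w1.
by rewrite /blaschke_factor; field; rewrite dz dw.
Qed.

(** The constant 4 is 2 * 2: at distance at most (1 - |w|)/2 the denominator at z is at least half
    of that at w, and (1 - b^2)/(1 - |w|^2) <= 2 (1 - b)/(1 - |w|) for b the modulus of the factor
    at w. *)
Lemma inner_like_blaschke_factor a : nc a < 1 -> inner_like (blaschke_factor a).
Proof.
move=> a1; have aa : 0 < 1 - nc a ^+ 2 by rewrite subr_gt0 expr_lt1 // normc_ge0.
have b1 z : nc z <= 1 -> nc (blaschke_factor a z) <= 1.
  move=> z1; have h := blaschke_factor_sqr a1 z1.
  rewrite -(@expr_le1 _ 2) ?normc_ge0 // -subr_ge0 h.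
  apply: divr_ge0; last by rewrite exprn_ge0 ?normc_ge0.
  by rewrite mulr_ge0 ?(ltW aa) // subr_ge0 expr_le1 ?normc_ge0.
split=> //.
- move=> z z1; have [_ d0] := blaschke_den a1 z1.
  apply: holoM; first exact: holo_subc.
  have d0' : 1 + (- a^*) * z != 0 by rewrite mulNr.
  apply: holo_near (expands_affineV d0'); apply: nearcW => w; by rewrite mulNr.
- move=> z z1; have := blaschke_factor_sqr a1 (_ : nc z <= 1).
  rewrite z1 expr1n subrr mulr0 mul0r => /(_ (lexx _)) /eqP; rewrite subr_eq0 => /eqP h.
  by apply/eqP; rewrite -(@eqrXn2 _ 2) ?normc_ge0 // -h expr1n.
move=> z w z1 w1 zw.
have [_ dz] := blaschke_den a1 (ltW z1); have [lw dw] := blaschke_den a1 (ltW w1).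
have -> : nc (blaschke_factor a z - blaschke_factor a w) =
    (1 - nc a ^+ 2) * nc (z - w) / (nc (1 - a^* * z) * nc (1 - a^* * w)).
  rewrite blaschke_factor_sub ?ltW // !normcM normc_inv normcM; congr (_ * _ / _).
  by rewrite mulcJ_normc -(rmorph1 (real_complex R)) -rmorphB normc_real ger0_norm // ltW.
have nw : 0 < 1 - nc w by rewrite subr_gt0.
have N0 : 0 < nc (1 - a^* * w) by rewrite normc_gt0.
have M0 : 0 < nc (1 - a^* * z) by rewrite normc_gt0.
have NM : nc (1 - a^* * w) / 2 <= nc (1 - a^* * z).
  have := normc_sub_le (1 - a^* * w) (1 - a^* * z).
  have -> : 1 - a^* * w - (1 - a^* * z) = a^* * (z - w) by ring.
  rewrite normcM normc_conj.
  have : nc a * nc (z - w) <= nc (z - w) by rewrite ler_piMl ?normc_ge0 // ltW.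
  lra.
have bw := blaschke_factor_sqr a1 (ltW w1); have bw1 := b1 w (ltW w1).
have nb := normc_ge0 (blaschke_factor a w).
set b := nc (blaschke_factor a w) in bw bw1 nb *.
set N := nc (1 - a^* * w) in N0 NM bw lw *.
set M := nc (1 - a^* * z) in M0 NM *.
set t := nc (z - w); have t0 : 0 <= t := normc_ge0 _.
set A := 1 - nc a ^+ 2 in aa bw *.
apply: (@le_trans _ _ (2 * (A / N ^+ 2) * t)).
  have -> : A * t / (M * N) = (A / N) * t * M^-1 by field; rewrite !gt_eqF.
  have -> : 2 * (A / N ^+ 2) * t = (A / N) * t * (2 / N) by field; rewrite !gt_eqF.
  apply: ler_wpM2l; first by rewrite mulr_ge0 // divr_ge0 // ltW.
  by rewrite -[2 / N]invf_div lef_pV2 ?posrE ?divr_gt0.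
have -> : 2 * (A / N ^+ 2) * t = 2 * ((1 - b ^+ 2) / (1 - nc w ^+ 2)) * t.
  congr (_ * _ * _); rewrite bw; field.
  by rewrite (gt_eqF N0) andbT gt_eqF // subr_gt0 expr_lt1 ?normc_ge0.
have ww : nc w ^+ 2 <= nc w by rewrite expr2 ler_piMr ?normc_ge0 // ltW.
have -> : 4 * (1 - b) * (t / (1 - nc w)) = 2 * ((2 * (1 - b)) / (1 - nc w)) * t by field; rewrite gt_eqF.
apply: ler_wpM2r => //; apply: ler_wpM2l => //.
apply: ler_pM.
- by rewrite subr_ge0 expr_le1.
- by rewrite invr_ge0 subr_ge0 expr_le1 ?normc_ge0 // ltW.
- have -> : 1 - b ^+ 2 = (1 + b) * (1 - b) by ring.
  by apply: ler_wpM2r; rewrite ?subr_ge0 //; lra.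
- by rewrite lef_pV2 ?posrE //; lra.
Qed.

Lemma inner_like_lt1_holo B z : inner_like B -> nc z < 1 -> holo B z.
Proof. by move=> [h _ _ _] z1; apply: h; exact: ltW. Qed.

End InnerFactors.

(** * Bounds for 1 - |B| and for the oscillation of B *)

Section KeyEstimates.
Context {R : realType}.
Implicit Types (F G B : R[i] -> R[i]) (z : R[i]) (w : R -> R) (C K L m : R).

Lemma lip_closed_disk F w L : majorant w -> 0 <= L ->
  (forall z, nc z <= 1 -> holo F z) ->
  (forall z1 z2, nc z1 < 1 -> nc z2 < 1 -> z1 != z2 ->
     nc (F z1 - F z2) <= L * w (nc (z1 - z2))) ->
  forall z1 z2, nc z1 <= 1 -> nc z2 <= 1 -> z1 != z2 ->
     nc (F z1 - F z2) <= L * w (nc (z1 - z2)).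
Proof.
move=> hw L0 hF hL z1 z2 n1 n2 z12.
apply/ler_addgt0Pl => e e0.
have e2 : 0 < e / 2 by rewrite divr_gt0.
have [r1 r10 h1] := holo_cts (hF z1 n1) e2; have [r2 r20 h2] := holo_cts (hF z2 n2) e2.
(* Scaling by 1 - s moves both points into the open disk and brings them closer together, so w of
   their distance does not increase; continuity of F absorbs the displacement. *)
pose s := Num.min (Num.min (r1 / 2) (r2 / 2)) (1 / 2).
have s0 : 0 < s by rewrite !lt_min !divr_gt0.
have sr1 : s < r1 by apply: (@le_lt_trans _ _ (r1 / 2)); [rewrite !ge_min lexx | lra].
have sr2 : s < r2 by apply: (@le_lt_trans _ _ (r2 / 2)); [rewrite !ge_min lexx orbT | lra].
have s1 : s <= 1 / 2 by rewrite !ge_min lexx !orbT.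
pose t : R[i] := (1 - s)%:C.
have nt : nc t = 1 - s by rewrite normc_real ger0_norm; lra.
have close z : nc z <= 1 -> nc (t * z - z) <= s.
  move=> nz; have -> : t * z - z = (- s)%:C * z.
    by rewrite /t rmorphB rmorph1 rmorphN; ring.
  by rewrite normcM normc_real normrN gtr0_norm // ler_piMr // ltW.
have inD z : nc z <= 1 -> nc (t * z) < 1.
  by move=> nz; rewrite normcM nt; have := normc_ge0 z; nra.
have t0 : t != 0 by rewrite -normc_gt0 nt; lra.
have tz : t * z1 != t * z2 by apply: contra z12 => /eqP/(mulfI t0)/eqP.
have := hL _ _ (inD z1 n1) (inD z2 n2) tz.
have n12 : 0 < nc (z1 - z2) by rewrite normc_gt0 subr_eq0.
have : w (nc (t * z1 - t * z2)) <= w (nc (z1 - z2)).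
  rewrite -mulrBr normcM nt; apply: (majorant_le hw).
    by rewrite mulr_gt0 //; lra.
  by rewrite ler_piMl ?normc_ge0 //; lra.
move=> /(ler_wpM2l L0) k1 k2.
have j1 := h1 (t * z1) (le_lt_trans (close z1 n1) sr1).
have j2 := h2 (t * z2) (le_lt_trans (close z2 n2) sr2).
have -> : F z1 - F z2 = (F (t * z1) - F (t * z2)) - (F (t * z1) - F z1) + (F (t * z2) - F z2) by ring.
apply: le_trans (normcD _ _) _.
have := normcB (F (t * z1) - F (t * z2)) (F (t * z1) - F z1); lra.
Qed.

(* [a / (a + t)] with [Re a >= 0] has nonnegative real part, at least 1/4 when
   [|a| >= t]; sums of such terms majorize w(|a|) on the circle. *)
Lemma Re_div_add (a : R[i]) (t : R) : 0 <= re a -> 0 < t ->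
  [/\ a + t%:C != 0, 0 <= re (a / (a + t%:C)) &
      t <= nc a -> 1 / 4 <= re (a / (a + t%:C))].
Proof.
move=> a0 t0.
have d0 : a + t%:C != 0.
  by apply/eqP; case: (a) a0 => x y /= x0 [h _]; lra.
have n0 : 0 < nc (a + t%:C) ^+ 2 by rewrite exprn_gt0 // normc_gt0.
have E : re (a / (a + t%:C)) = (nc a ^+ 2 + t * re a) / nc (a + t%:C) ^+ 2.
  rewrite !normc_sqr in n0 *; case: (a) n0 => x y /=; rewrite addr0 => n0.
  by field; rewrite gt_eqF.
split=> //; rewrite E.
  by rewrite divr_ge0 ?(ltW n0) // addr_ge0 ?mulr_ge0 ?(ltW t0) ?exprn_ge0 ?normc_ge0.
move=> ta; rewrite ler_pdivlMr //.
have h : nc (a + t%:C) <= 2 * nc a.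
  by have := normcD a t%:C; rewrite normc_real gtr0_norm //; lra.
have h2 : nc (a + t%:C) ^+ 2 <= (2 * nc a) ^+ 2.
  by apply: lerXn2r => //; rewrite nnegrE ?mulr_ge0 ?normc_ge0.
have : 0 <= t * re a by rewrite mulr_ge0 // ltW.
rewrite exprMn in h2; lra.
Qed.

Lemma Re_sum (I : Type) (s : seq I) (X : I -> R[i]) :
  re (\sum_(i <- s) X i) = \sum_(i <- s) re (X i).
Proof. by apply: (big_morph (fun z : R[i] => re z)) => // -[a b] [c d]. Qed.

Lemma one_sub_inner_le F B G w C L m : majorant w ->
  (forall d (n : nat), 0 < d -> d < 2 -> \sum_(k < n) w (2 ^+ k * d) / 2 ^+ k <= 4 * C * w d) ->
  inner_like B ->
  (forall z, nc z <= 1 -> holo F z) -> (forall z, nc z <= 1 -> holo G z) ->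
  (forall z, nc z <= 1 -> F z = B z * G z) ->
  0 <= L ->
  (forall z1 z2, nc z1 < 1 -> nc z2 < 1 -> z1 != z2 ->
     nc (F z1 - F z2) <= L * w (nc (z1 - z2))) ->
  0 < m -> (forall z, nc z = 1 -> m <= nc (F z)) ->
  forall z, nc z < 1 -> m * (1 - nc (B z)) <= L * (2 + 32 * C) * w (1 - nc z).
Proof.
move=> hw sumw [hB B1 BT _] hF hG FBG L0 hL0 m0 mF z z1.
have hL := lip_closed_disk hw L0 hF hL0.
(* q is z/|z|, or some point of the circle when z = 0. *)
have [t _ zt] := polar z; set q := cis t in zt.
have q1 : nc q = 1 by exact: normc_cis.
set d := 1 - nc z; have d0 : 0 < d by rewrite subr_gt0.
have d1 : d <= 1 by have := normc_ge0 z; rewrite /d; lra.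
have d2 : d < 2 by lra.
set A := nc (F q).
have mA : m <= A by exact: mF.
(* 2^K d exceeds the diameter of the disk, so K dyadic annuli around q together with the disk of
   radius d cover the circle. *)
pose K := Num.bound (2 / d).
have Kd : 2 < 2 ^+ K * d.
  have : 2 / d < K%:R by apply: archi_boundP; rewrite divr_ge0 // ltW.
  rewrite ltr_pdivrMr // => h; apply: lt_trans h _; rewrite ltr_pM2r //.
  by rewrite -natrX ltr_nat ltn_expl.
(* A holomorphic stand-in for |x - q|: it has this modulus, and nonnegative real part on the closed
   disk. The k-th term of [Phi] is meant for the annulus 2^k d < |x - q| <= 2^(k+1) d, where the
   coefficient 4 offsets the lower bound 1/4 of [Re_div_add]. *)
pose al (x : R[i]) : R[i] := 1 - q^* * x.
pose Phi (x : R[i]) : R[i] := (A + L * w d)%:C +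
  \sum_(k < K) (4 * L * w (2 ^+ k.+1 * d))%:C * (al x / (al x + (2 ^+ k * d)%:C)).
have p2 k : 0 < 2 ^+ k * d by rewrite mulr_gt0 // exprn_gt0.
have wp k : 0 <= w (2 ^+ k * d) by exact: (majorant_ge0 hw).
have wd : 0 <= w d by exact: (majorant_ge0 hw).
have Re_al x : nc x <= 1 -> 0 <= re (al x).
  move=> x1; have := Re_le_normc (q^* * x); rewrite normcM normc_conj q1 mul1r.
  have -> : re (al x) = 1 - re (q^* * x) by rewrite /al; case: (q^* * x).
  lra.
have Re_real (r : R) (x : R[i]) : re (r%:C * x) = r * re x.
  by case: x => a b; simpc.
have Re_Phi x : re (Phi x) = A + L * w d +
    \sum_(k < K) 4 * L * w (2 ^+ k.+1 * d) * re (al x / (al x + (2 ^+ k * d)%:C)).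
  rewrite /Phi -(eq_bigr _ (fun k _ => Re_real _ _)) -Re_sum.
  by case: (\sum_(i < K) _).
have term_ge0 x k : nc x <= 1 -> 0 <= 4 * L * w (2 ^+ k.+1 * d) * re (al x / (al x + (2 ^+ k * d)%:C)).
  move=> x1; have [_ h _] := Re_div_add (Re_al x x1) (p2 k).
  by rewrite !mulr_ge0.
have Phi_ge x : nc x <= 1 -> A + L * w d <= re (Phi x).
  by move=> x1; rewrite Re_Phi lerDl; apply: sumr_ge0 => k _; exact: term_ge0.
have GPhi : forall x, nc x <= 1 -> nc (G x) <= nc (Phi x).
  apply: max_principle_ratio => //.
  - move=> x x1; apply: holoD; first exact: holo_cst.
    apply: holo_sum => k; apply: holoM; first exact: holo_cst.
    have [n0 _ _] := Re_div_add (Re_al x x1) (p2 k).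
    apply: holoM.
      apply: holo_near (holoD (holo_cst 1 x) (holoM (holo_cst (- q^*) x) (holo_subc 0 x))).
      by apply: nearcW => y; rewrite /al subr0 mulNr.
    have n0' : (1 + (2 ^+ k * d)%:C) + (- q^*) * x != 0.
      by move: n0; rewrite /al mulNr addrAC.
    apply: holo_near (expands_affineV n0'); apply: nearcW => y.
    by rewrite /al mulNr addrAC.
  - move=> x x1; apply/eqP => P0; have := Phi_ge x x1; rewrite P0 /=.
    have : 0 <= L * w d by rewrite mulr_ge0.
    lra.
  move=> x x1; have x1' : nc x <= 1 by rewrite x1.
  apply: le_trans (Re_le_normc _).
  have GF : nc (G x) = nc (F x) by rewrite FBG // normcM BT // mul1r.
  have nal : nc (al x) = nc (x - q).
    have -> : al x = - q^* * (x - q).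
      by rewrite mulrBr !mulNr opprK [q^* * q]mulrC mulcJ_normc q1 expr1n addrC.
    by rewrite normcM normcN normc_conj q1 mul1r.
  have [xq|xq] := eqVneq x q.
    apply: le_trans (Phi_ge x x1'); rewrite GF xq lerDl; exact: mulr_ge0.
  have FF : nc (F x) <= A + L * w (nc (al x)).
    have := hL x q x1' _ xq; rewrite q1 => /(_ (lexx _)) h.
    by have := normc_sub_le (F x) (F q); rewrite nal /A; lra.
  rewrite GF; apply: le_trans FF _.
  have al0 : 0 < nc (al x) by rewrite nal normc_gt0 subr_eq0.
  have al2 : nc (al x) <= 2 by rewrite nal; have := normcB x q; rewrite x1 q1; lra.
  have [ad|ad] := leP (nc (al x)) d.
    apply: le_trans (Phi_ge x x1'); rewrite lerD2l ler_wpM2l //.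
    exact: majorant_le hw al0 ad.
  have [k kK [ka ka1]] : exists2 k, (k < K)%N &
      2 ^+ k * d < nc (al x) /\ nc (al x) <= 2 ^+ k.+1 * d.
    have : nc (al x) <= 2 ^+ K * d by lra.
    elim: (K) => [|k IH] h; first by move: h; rewrite expr0 mul1r leNgt ad.
    have [h'|h'] := leP (nc (al x)) (2 ^+ k * d).
      by have [j jk hj] := IH h'; exists j => //; exact: ltnW.
    by exists k.
  rewrite Re_Phi (bigD1 (Ordinal kK)) //=.
  set S := \sum_(_ < _ | _) _.
  have S0 : 0 <= S by apply: sumr_ge0 => i _; exact: term_ge0.
  have [_ _ h] := Re_div_add (Re_al x x1') (p2 k).
  have {}h := h (ltW ka).
  have ww : w (nc (al x)) <= w (2 ^+ k.+1 * d) by exact: majorant_le hw al0 ka1.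
  have := ler_wpM2l (mulr_ge0 (mulr_ge0 (ler0n R 4) L0) (wp k.+1)) h.
  have := ler_wpM2l L0 ww; have := mulr_ge0 L0 wd; lra.
have alz : al z = d%:C.
  by rewrite /al zt mulrCA [q^* * q]mulrC mulcJ_normc q1 expr1n mulr1 /d rmorphB.
have Pz : nc (Phi z) <= A + L * w d + 32 * C * L * w d.
  apply: le_trans (normcD _ _) _; rewrite normc_real ger0_norm; last first.
    by rewrite addr_ge0 ?normc_ge0 // mulr_ge0.
  rewrite lerD2l; apply: le_trans (normc_sum _ _ _) _.
  (* As al z = d, the quotient in the k-th term is 1/(1 + 2^k) at z; with w(2t) <= 2 w(t) this gives
     the summands to which [sumw] applies, with total 8 * 4 C L w(d). *)
  apply: (@le_trans _ _ (\sum_(k < K) 8 * L * (w (2 ^+ k * d) / 2 ^+ k))).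
    apply: ler_sum => k _; rewrite alz -rmorphD -fmorphV -!rmorphM normc_real.
    have e0 : 0 <= d / (d + 2 ^+ k * d)
      by apply: divr_ge0; [exact: ltW | apply: addr_ge0; exact: ltW].
    have c0 : 0 <= 4 * L * w (2 ^+ k.+1 * d) by apply: mulr_ge0 => //; exact: mulr_ge0.
    rewrite ger0_norm; last exact: mulr_ge0.
    have -> : 8 * L * (w (2 ^+ k * d) / 2 ^+ k) = 4 * L * (2 * w (2 ^+ k * d)) * (2 ^+ k)^-1 by ring.
    apply: ler_pM => //.
      apply: ler_wpM2l; first by rewrite mulr_ge0.
      by rewrite exprS -mulrA; exact: majorant_double hw (p2 k).
    have -> : d / (d + 2 ^+ k * d) = (1 + 2 ^+ k)^-1.
      have -> : d + 2 ^+ k * d = d * (1 + 2 ^+ k) by ring.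
      by rewrite invfM mulrA divff ?mul1r // gt_eqF.
    by rewrite lef_pV2 ?posrE ?addr_gt0 ?exprn_gt0 // lerDr.
  rewrite -mulr_sumr; have := sumw d K d0 d2 => /(ler_wpM2l (mulr_ge0 (ler0n R 8) L0)).
  by move=> h; apply: le_trans h _; rewrite le_eqVlt; apply/orP; left; apply/eqP; ring.
have Gz := le_trans (GPhi z (ltW z1)) Pz.
have Fz : A - L * w d <= nc (F z).
  have [zq|zq] := eqVneq q z; first by rewrite /A zq gerBl mulr_ge0.
  have h := hL q z _ (ltW z1) zq; rewrite q1 in h; have {}h := h (lexx _).
  have qz : nc (q - z) = d.
    have -> : q - z = d%:C * q by rewrite {1}zt /d rmorphB rmorph1; ring.
    by rewrite normcM q1 mulr1 normc_real gtr0_norm.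
  rewrite qz in h; have := normc_sub_le (F q) (F z); rewrite -/A; lra.
rewrite FBG ?(ltW z1) // normcM in Fz.
have b1 := B1 z (ltW z1); have b0 := normc_ge0 (B z).
set b := nc (B z) in b1 b0 Fz *; rewrite -/d.
have Lw : 0 <= L * w d by rewrite mulr_ge0.
(* The sign is read off from [sumw] with a single term. *)
have C0 : 0 <= C * (L * w d).
  have := sumw d 1%N d0 d2; rewrite big_ord1 expr0 mul1r divr1 => h.
  have h4 : 0 <= 4 * C * w d by exact: le_trans h.
  have -> : C * (L * w d) = L * (4 * C * w d) / 4 by field.
  by rewrite divr_ge0 // mulr_ge0.
(* The factor b is dropped from the error terms but kept on A: together with A - L w(d) <= b |G z|
   this isolates A (1 - b). *)
have k1 : b * nc (G z) <= b * A + (L * w d + 32 * (C * (L * w d))).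
  apply: (@le_trans _ _ (b * (A + L * w d + 32 * C * L * w d))).
    by rewrite ler_wpM2l.
  have -> : b * (A + L * w d + 32 * C * L * w d) = b * A + b * (L * w d + 32 * (C * (L * w d))) by ring.
  by rewrite lerD2l ler_piMl // addr_ge0 // mulr_ge0.
have k2 : m * (1 - b) <= A * (1 - b) by rewrite ler_wpM2r // subr_ge0.
have -> : L * (2 + 32 * C) * w d = 2 * (L * w d) + 32 * (C * (L * w d)) by ring.
apply: le_trans k2 _; rewrite mulrBr mulr1 mulrC; lra.
Qed.

(** For d = |z1 - z2| <= 1/2 both points are moved radially to (1 - 2d) z1 and (1 - 2d) z2, where
    the Schwarz-Pick clause applies directly. Each radial move costs 8 K C w(d) and the middle step
    4 K w(d). *)
Lemma inner_lip B w C K : majorant w ->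
  (forall d k, 0 < d -> d < 2 -> \sum_(i < k) w (d / 2 ^+ i) <= 2 * C * w d) ->
  inner_like B -> 0 <= K ->
  (forall z, nc z < 1 -> 1 - nc (B z) <= K * w (1 - nc z)) ->
  forall z1 z2, nc z1 < 1 -> nc z2 < 1 -> z1 != z2 ->
    nc (B z1 - B z2) <= K * (16 * C + 4) * w (nc (z1 - z2)).
Proof.
move=> hw sumw hB K0 BK.
(* With D = 1 - |x|, monotonicity of w(t)/t trades w(D) l / D for w(l). *)
have close z x (l : R) : nc z < 1 -> nc x < 1 -> 0 < l -> nc (z - x) <= l ->
    l <= (1 - nc x) / 2 -> nc (B z - B x) <= 4 * K * w l.
  move=> z1 x1 l0 zx lx; have [_ _ _ h] := hB.
  have := h z x z1 x1 (le_trans zx lx) => /le_trans; apply.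
  set D := 1 - nc x; have D0 : 0 < D by rewrite subr_gt0.
  apply: (@le_trans _ _ (4 * (K * w D) * (l / D))).
    apply: ler_pM.
    - by rewrite mulr_ge0 // subr_ge0; have [_ b1 _ _] := hB; apply: b1; exact: ltW.
    - by rewrite divr_ge0 ?normc_ge0 // ltW.
    - by rewrite ler_wpM2l // BK.
    - by rewrite ler_pM2r ?invr_gt0.
  have := majorant_div_le hw l0 (_ : l <= D); rewrite ler_pdivrMr // => hh.
  have lD : l <= D by move: lx; rewrite -/D; lra.
  have {}hh := hh lD.
  have -> : 4 * (K * w D) * (l / D) = 4 * K * (w D * l / D) by ring.
  apply: ler_wpM2l; first by rewrite mulr_ge0.
  rewrite ler_pdivrMr //; move: hh; rewrite mulrAC ler_pdivlMr //.
have chain z (h : R) : nc z < 1 -> 0 < h -> h <= 1 / 2 ->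
    nc (B z - B ((1 - 2 * h)%:C * z)) <= 8 * K * C * w h.
  move=> z1 h0 h2.
  (* Consecutive radii differ by h / 2^k, and 1 - |r_k z| >= 2 h / 2^k: every step is just short
     enough for [close]. The bound h <= 1/2 keeps all radii nonnegative. *)
  pose r k : R := 1 - h * 2 / 2 ^+ k.
  have e0 k : 0 < h / 2 ^+ k by rewrite divr_gt0 // exprn_gt0.
  have eh k : h / 2 ^+ k <= h.
    by rewrite ler_pdivrMr ?exprn_gt0 // ler_peMr ?(ltW h0) // exprn_ege1 // ler1n.
  have rE k : r k = 1 - 2 * (h / 2 ^+ k) by rewrite /r; ring.
  have r0 k : 0 <= r k by rewrite rE; have := eh k; lra.
  have rz k : nc ((r k)%:C * z) <= r k.
    by rewrite normcM normc_real ger0_norm // ler_piMr // ltW.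
  have r1 k : r k < 1 by rewrite rE; have := e0 k; lra.
  have step k : nc (B ((r k.+1)%:C * z) - B ((r k)%:C * z)) <= 4 * K * w (h / 2 ^+ k).
    apply: close => //; try exact: le_lt_trans (rz _) (r1 _).
      rewrite -mulrBl -rmorphB normcM normc_real.
      have -> : r k.+1 - r k = h / 2 ^+ k.
        by rewrite /r exprS; field; rewrite expf_neq0.
      by rewrite gtr0_norm // ler_piMr // ltW.
    by have := rz k; rewrite rE; lra.
  have sumB k : nc (B ((r k)%:C * z) - B ((r 0%N)%:C * z)) <= 8 * K * C * w h.
    apply: (@le_trans _ _ (4 * K * \sum_(i < k) w (h / 2 ^+ i))).
      elim: k => [|k IH]; first by rewrite subrr Normc.normc0 big_ord0 mulr0.
      rewrite big_ord_recr mulrDr /= [leRHS]addrC.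
      by apply: le_trans (normc_triangle _ (B ((r k)%:C * z)) _) _; exact: lerD.
    have := sumw h k h0 => /(_ _)/(ler_wpM2l (mulr_ge0 (ler0n R 4) K0)) => hh.
    have h2' : h < 2 by lra.
    apply: le_trans (hh h2') _.
    by rewrite le_eqVlt; apply/orP; left; apply/eqP; ring.
  have r00 : r 0%N = 1 - 2 * h by rewrite rE expr0 divr1.
  rewrite r00 in sumB.
  apply/ler_addgt0Pl => e ee.
  have [rr rr0 hc] := holo_cts (inner_like_lt1_holo hB z1) ee.
  pose N := Num.bound (2 * h / rr).
  have hN : 2 * h / rr < N%:R by apply: archi_boundP; rewrite divr_ge0 ?mulr_ge0 // ltW.
  have Nl := ltn_expl N (isT : (1 < 2)%N); rewrite -(ltr_nat R) natrX in Nl.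
  have zN : nc ((r N)%:C * z - z) < rr.
    have -> : (r N)%:C * z - z = (- (2 * (h / 2 ^+ N)))%:C * z.
      by rewrite rE rmorphB rmorph1 rmorphN; ring.
    rewrite normcM normc_real normrN gtr0_norm ?mulr_gt0 //.
    apply: le_lt_trans (_ : _ <= 2 * (h / 2 ^+ N)) _.
      by rewrite ler_piMr ?mulr_ge0 ?(ltW (e0 N)) // ltW.
    rewrite mulrA ltr_pdivrMr ?exprn_gt0 //.
    by have := lt_trans hN Nl; rewrite ltr_pdivrMr // [rr * _]mulrC.
  apply: le_trans (normc_triangle _ (B ((r N)%:C * z)) _) _; apply: lerD => //.
  by rewrite normc_distC ltW // hc.
move=> z1 z2 n1 n2 z12.
set d := nc (z1 - z2); have d0 : 0 < d by rewrite normc_gt0 subr_eq0.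
have wd : 0 <= w d by exact: (majorant_ge0 hw).
have [dh|dh] := leP d (1 / 2).
  have c1 := chain z1 d n1 d0 dh; have c2 := chain z2 d n2 d0 dh.
  set t : R[i] := (1 - 2 * d)%:C in c1 c2.
  have nt : nc t = 1 - 2 * d by rewrite normc_real ger0_norm; lra.
  have tz z : nc z < 1 -> nc (t * z) <= 1 - 2 * d.
    move=> nz; rewrite normcM nt ler_piMr //; last exact: ltW.
    by move: dh; lra.
  have c3 : nc (B (t * z1) - B (t * z2)) <= 4 * K * w d.
    apply: close => //.
    - by apply: le_lt_trans (tz z1 n1) _; lra.
    - by apply: le_lt_trans (tz z2 n2) _; lra.
    - by rewrite -mulrBr normcM nt ler_piMl ?normc_ge0 //; lra.
    - by have := tz z2 n2; lra.
  have -> : B z1 - B z2 = (B z1 - B (t * z1)) - (B z2 - B (t * z2)) + (B (t * z1) - B (t * z2)) by ring.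
  apply: le_trans (normcD _ _) _.
  have := normcB (B z1 - B (t * z1)) (B z2 - B (t * z2)); lra.
(* Distant points are joined through the origin: for h = 1/2 the chain ends at (1 - 2h) z = 0, and
   w(1/2) <= w(d). *)
have h0 : 0 < 1 / 2 :> R by lra.
have c1 := chain z1 _ n1 h0 (lexx _); have c2 := chain z2 _ n2 h0 (lexx _).
have e : 1 - 2 * (1 / 2) = 0 :> R by field.
rewrite e rmorph0 !mul0r in c1 c2.
have w2 : w (1 / 2) <= w d by exact: majorant_le hw h0 (ltW dh).
have C0 : 0 <= 8 * K * C * w (1 / 2) by apply: le_trans c1; exact: normc_ge0.
have wh : 0 < w (1 / 2) by have [wp _ _ _ _] := hw; exact: wp.
have KC : 0 <= 8 * K * C by rewrite -(pmulr_lge0 _ wh).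
have -> : B z1 - B z2 = (B z1 - B 0) - (B z2 - B 0) by ring.
apply: le_trans (normcB _ _) _.
have := ler_wpM2l KC w2; have : 0 <= K * w d by rewrite mulr_ge0.
lra.
Qed.

End KeyEstimates.

(** * Multiplicities and division *)

Section Multiplicities.
Context {R : realType}.
Implicit Types (f g F G : R[i] -> R[i]) (a b z : R[i]) (mu : R[i] -> nat) (s : seq R[i]).

Lemma dvd_at_le m n f a : (m <= n)%N -> dvd_at n f a -> dvd_at m f a.
Proof.
by move=> mn [c [hc c0]]; exists c; split=> // k km; apply: c0; exact: leq_trans mn.
Qed.

Lemma dvd_at_near m f g a : (\forall z \near a, f z = g z) -> dvd_at m f a -> dvd_at m g a.
Proof. by move=> fg [c [hc c0]]; exists c; split=> //; exact: expands_near hc. Qed.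

Lemma dvd_at_holo m f a : dvd_at m f a -> holo f a.
Proof. by move=> [c [hc _]]; exists c. Qed.

Lemma dvd_at0 f a : holo f a -> dvd_at 0 f a.
Proof. by move=> [c hc]; exists c. Qed.

Lemma dvd_atM m n f g a : dvd_at m f a -> dvd_at n g a ->
  dvd_at (m + n) (fun z => f z * g z) a.
Proof.
move=> /dvd_atP[f1 [hf1 ef]] /dvd_atP[g1 [hg1 eg]]; apply/dvd_atP.
exists (fun z => f1 z * g1 z); split; first exact: holoM.
by apply: nearcS (nearcI ef eg) => z [-> ->]; rewrite exprD; ring.
Qed.

Lemma dvd_atMr m f g a : dvd_at m f a -> holo g a -> dvd_at m (fun z => f z * g z) a.
Proof. by move=> hf /dvd_at0 hg; have := dvd_atM hf hg; rewrite addn0. Qed.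

Lemma dvd_atX m f a k : dvd_at m f a -> dvd_at (m * k) (fun z => f z ^+ k) a.
Proof.
move=> hf; elim: k => [|k IH].
  by rewrite muln0; apply: dvd_at0; apply: holoX; exact: dvd_at_holo hf.
rewrite mulnS; apply: dvd_at_near (dvd_atM hf IH); apply: nearcW => z.
by rewrite exprS.
Qed.

Lemma dvd_at_sum (I : Type) (s : seq I) (F : I -> R[i] -> R[i]) m a :
  (forall i, dvd_at m (F i) a) -> dvd_at m (fun z => \sum_(i <- s) F i z) a.
Proof.
move=> hF; elim: s => [|i s [c [hc c0]]].
  exists (fun k => if k == 0%N then 0 else 0); split=> [|k _]; last by case: ifP.
  by apply: expands_near (expands_cst 0 a); apply: nearcW => z; rewrite big_nil.
have [d [hd d0]] := hF i.
exists (fun k => d k + c k); split=> [|k km]; last by rewrite d0 // c0 // addr0.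
by apply: expands_near (expandsD hd hc); apply: nearcW => z; rewrite big_cons.
Qed.

Lemma expands_shift m g a (d : nat -> R[i]) : expands g a d ->
  expands (fun z => (z - a) ^+ m * g z) a (fun k => if (k < m)%N then 0 else d (k - m)%N).
Proof.
move=> hd; elim: m => [|m IH].
  apply: expands_ext (expands_near _ hd) => [k|]; first by rewrite subn0.
  by apply: nearcW => z; rewrite mul1r.
apply: expands_ext (expands_near _ (expands_mulX IH)) => [[|k] //|].
by apply: nearcW => z; rewrite exprS mulrA.
Qed.

Lemma vanishing_orderP f a m : vanishing_order f a m <-> exists c,
  [/\ expands f a c, forall k, (k < m)%N -> c k = 0 & c m != 0].
Proof.
split=> [[g [/holo_analytic[d hd] ga fg]]|[c [hc c0 cm]]].
  exists (fun k => if (k < m)%N then 0 else d (k - m)%N); split.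
  - by apply: expands_near (expands_shift m hd); apply: nearcS fg => z ->.
  - by move=> k ->.
  - by rewrite ltnn subnn -(expands_val hd).
have [g [hg fg]] := expands_dvd hc c0.
exists g; split; first by apply: analytic_holo; eexists; exact: hg.
  by rewrite (expands_val hg) add0n.
exact: nearcW.
Qed.

Lemma vanishing_order_uniq f a m n : vanishing_order f a m -> vanishing_order f a n -> m = n.
Proof.
move=> /vanishing_orderP[c [hc c0 cm]] /vanishing_orderP[d [hd d0 dn]].
have cd := expands_uniq hc hd.
by case: (ltngtP m n) => // [mn|nm]; [move: cm; rewrite cd d0 // eqxx | move: dn; rewrite -cd c0 // eqxx].
Qed.

Lemma vanishing_order_mult f a m : vanishing_order f a m -> multiplicity f a = m.
Proof.
by move=> fm; apply: xget_unique => // n fn; exact: vanishing_order_uniq fn fm.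
Qed.

(** A positive value cannot be the default 0 of [xget], so it is a genuine order. *)
Lemma multiplicity_dvd f a : (0 < multiplicity f a)%N -> dvd_at (multiplicity f a) f a.
Proof.
rewrite /multiplicity; case: xgetP => // m _ /vanishing_orderP[c [hc c0 _]] _.
by exists c.
Qed.

Lemma vanishing_orderM f g a m n : vanishing_order f a m -> vanishing_order g a n ->
  vanishing_order (fun z => f z * g z) a (m + n).
Proof.
move=> [f1 [/holo_analytic hf1 f1a ef]] [g1 [/holo_analytic hg1 g1a eg]].
exists (fun z => f1 z * g1 z); split.
- by apply: analytic_holo; exact: holoM.
- by rewrite mulf_neq0.
- by apply: nearcS (nearcI ef eg) => z [-> ->]; rewrite exprD; ring.
Qed.

Lemma vanishing_order_near f g a m : (\forall z \near a, f z = g z) ->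
  vanishing_order f a m -> vanishing_order g a m.
Proof.
move=> fg [h [hh ha eh]]; exists h; split=> //.
by apply: nearcS (nearcI fg eh) => z [<- <-].
Qed.

Lemma vanishing_order_prod (I : Type) (t : seq I) (F : I -> R[i] -> R[i]) (m : I -> nat) a :
  (forall i, vanishing_order (F i) a (m i)) ->
  vanishing_order (fun z => \prod_(i <- t) F i z) a (\sum_(i <- t) m i).
Proof.
move=> hF; elim: t => [|i t IH].
  rewrite big_nil; exists (fun=> 1); split.
  - by apply: analytic_holo; exact: holo_cst.
  - exact: oner_neq0.
  - by apply: nearcW => z; rewrite big_nil mulr1.
rewrite big_cons; apply: vanishing_order_near (vanishing_orderM (hF i) IH).
by apply: nearcW => z; rewrite big_cons.
Qed.

(** The list may contain points where [mu] is 0, so that one list can serve several multiplicity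
    functions. *)
Definition supported s mu : Prop :=
  [/\ uniq s, forall a, a \in s -> nc a < 1 &
      forall a, nc a < 1 -> a \notin s -> mu a = 0%N].

Lemma blaschke_prod s mu z : supported s mu ->
  blaschke mu z = \prod_(a <- s) blaschke_factor a z ^+ mu a.
Proof.
move=> [us sD mu0]; rewrite /blaschke (fsbigE s) //.
- rewrite big_seq_cond [RHS]big_seq; apply: eq_bigl => a.
  by case as_ : (a \in s) => //=; apply/mem_set; rewrite /= normc_lt1 sD.
- by move=> a /= /sD; rewrite normc_lt1.
- by move=> a /=; rewrite normc_lt1 => a1 /(mu0 _ a1) ->.
Qed.

Lemma blaschke_factor_lt1 a z : nc a < 1 -> nc z < 1 -> nc (blaschke_factor a z) < 1.
Proof.
move=> a1 z1; have [_ d0] := blaschke_den a1 (ltW z1).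
rewrite -(@expr_lt1 _ 2) ?normc_ge0 // -subr_gt0 blaschke_factor_sqr ?ltW //.
by rewrite divr_gt0 ?mulr_gt0 ?subr_gt0 ?expr_lt1 ?normc_ge0 ?exprn_gt0 ?normc_gt0.
Qed.

(* With infinitely many prescribed zeros, [blaschke] is the junk value 1 at
   every point of the disk. *)
Lemma blaschke_supported mu : (exists s, supported s mu) \/
  (forall z, nc z < 1 -> blaschke mu z = 1).
Proof.
pose A : set R[i] := [set a | nc a < 1 /\ mu a <> 0%N].
have [/finite_seqP[s As]|infA] := pselect (finite_set A).
  left; exists (undup s); split; first exact: undup_uniq.
    move=> a; rewrite mem_undup => sa.
    by have [] : A a by rewrite As.
  move=> a a1; rewrite mem_undup => /negP sa; apply: contrapT => mua.
  by apply: sa; have : A a by []; rewrite As.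
right=> z z1; rewrite /blaschke no_finite_support ?big_nil // => finB; apply: infA.
apply: sub_finite_set finB => a [a1 mua]; split; first by rewrite /= normc_lt1.
move=> /= h; have := blaschke_factor_lt1 a1 z1.
have mu0 : (mu a != 0)%N by apply/eqP.
rewrite -(@expr_lt1 _ (mu a)) ?normc_ge0 ?lt0n //.
by rewrite -normcX h Normc.normc1 ltxx.
Qed.

Lemma vanishing_order_blaschke s mu a : supported s mu -> nc a < 1 ->
  vanishing_order (blaschke mu) a (mu a).
Proof.
move=> hs a1; have [us sD mu0] := hs.
(* For a outside s one has mu a = 0 and [rem a s] = s, so the same cofactor covers both cases. *)
exists (fun z => (1 + - a^* * z)^-1 ^+ mu a *
  \prod_(b <- rem a s) blaschke_factor b z ^+ mu b).
have hden z : 1 + - a^* * z = 1 - a^* * z by rewrite mulNr.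
have rD b : b \in rem a s -> nc b < 1 by move=> /mem_rem/sD.
have d0 : 1 - a^* * a != 0 by have [] := blaschke_den a1 (ltW a1).
split.
- apply: analytic_holo; apply: holoM.
    by apply: holoX; apply: expands_affineV; rewrite hden.
  apply: holo_prod => b bs; apply: holoX.
  by have [h _ _ _] := inner_like_blaschke_factor (rD b bs); apply: h; exact: ltW.
- rewrite mulf_neq0 ?expf_neq0 ?invr_neq0 ?hden //.
  rewrite prodf_seq_neq0; apply/allP => b bs /=; rewrite expf_neq0 // mulf_neq0 //.
    by rewrite subr_eq0; apply: contraTneq bs => <-; rewrite mem_rem_uniq // !inE eqxx.
  by rewrite invr_neq0 //; have [] := blaschke_den (rD b bs) (ltW a1).
apply: nearcW => z; rewrite (blaschke_prod _ hs).
have -> : \prod_(b <- s) blaschke_factor b z ^+ mu b =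
    blaschke_factor a z ^+ mu a * \prod_(b <- rem a s) blaschke_factor b z ^+ mu b.
  have [as_|as_] := boolP (a \in s).
    by rewrite (perm_big _ (perm_to_rem as_)) big_cons.
  by rewrite rem_id // mu0 // expr0 mul1r.
by rewrite mulrA hden /blaschke_factor exprMn.
Qed.

Lemma blaschke_of_mult f : exists s, supported s (multiplicity (blaschke_of f)) /\
  forall a, nc a < 1 ->
    vanishing_order (blaschke_of f) a (multiplicity (blaschke_of f) a) /\
    ((0 < multiplicity (blaschke_of f) a)%N ->
       dvd_at (multiplicity (blaschke_of f) a) f a).
Proof.
case: (blaschke_supported (multiplicity f)) => [[s hs]|h1].
  have E a : nc a < 1 -> multiplicity (blaschke_of f) a = multiplicity f a.
    by move=> a1; apply: vanishing_order_mult; exact: vanishing_order_blaschke hs a1.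
  have [us sD mu0] := hs; exists s; split; first by split=> // a a1 /(mu0 _ a1); rewrite E.
  move=> a a1; rewrite E //; split; first exact: vanishing_order_blaschke hs a1.
  exact: multiplicity_dvd.
have V a : nc a < 1 -> vanishing_order (blaschke_of f) a 0.
  move=> a1; exists (fun=> 1); split.
  - by apply: analytic_holo; exact: holo_cst.
  - exact: oner_neq0.
  apply/nearcP; exists (1 - nc a) => [|z za]; first by rewrite subr_gt0.
  rewrite expr0 mulr1 /blaschke_of h1 //.
  by have := normc_sub_le z a; lra.
have E a : nc a < 1 -> multiplicity (blaschke_of f) a = 0%N.
  by move=> a1; exact: vanishing_order_mult (V a a1).
exists [::]; split; first by split=> // a a1 _; exact: E.
by move=> a a1; rewrite E //; split=> //; exact: V.
Qed.

(** One zero is removed at a time. The quotient is holomorphic at a by its Taylor expansion and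
    elsewhere as a product with an inverse power of z - a, which also preserves its divisibility at
    the remaining points. *)
Lemma divide_blaschke s mu F : uniq s -> (forall a, a \in s -> nc a < 1) ->
  (forall z, nc z <= 1 -> holo F z) -> (forall a, a \in s -> dvd_at (mu a) F a) ->
  exists G, (forall z, nc z <= 1 -> holo G z) /\
    forall z, nc z <= 1 -> F z = \prod_(a <- s) blaschke_factor a z ^+ mu a * G z.
Proof.
elim: s F => [|a s IH] F us sD hF dF.
  by exists F; split=> // z _; rewrite big_nil mul1r.
have a1 : nc a < 1 by apply: sD; rewrite inE eqxx.
have [as_ {}us] := andP us.
have [c [hc c0]] : dvd_at (mu a) F a by apply: dF; rewrite inE eqxx.
have [g [hg Fg]] := expands_dvd hc c0.
have inv b : b != a -> holo (fun z => ((z - a) ^+ mu a)^-1) b.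
  move=> ba; have h : - a + 1 * b != 0 by rewrite mul1r addrC subr_eq0.
  apply: holo_near (holoX (mu a) (expands_affineV h)); apply: nearcW => z.
  by rewrite mul1r addrC exprVn.
have quot b : b != a -> \forall z \near b, F z * ((z - a) ^+ mu a)^-1 = g z.
  move=> ba; have : b - a != 0 by rewrite subr_eq0.
  move=> /(holo_neq0_near (holo_subc a b)); apply: nearcS => z za.
  by rewrite Fg mulrC mulKf // expf_neq0.
pose G1 z := g z * (1 - a^* * z) ^+ mu a.
have den z : holo (fun z => (1 - a^* * z) ^+ mu a) z.
  apply: holoX.
  apply: holo_near (holoD (holo_cst 1 z) (holoM (holo_cst (- a^*) z) (holo_subc 0 z))).
  by apply: nearcW => y; rewrite subr0 mulNr.
have hG1 z : nc z <= 1 -> holo G1 z.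
  move=> z1; apply: holoM; last exact: den.
  have [->|za] := eqVneq z a; first by eexists; exact: hg.
  by apply: holo_near (quot z za) _; apply: holoM; [exact: hF | exact: inv].
have dG1 b : b \in s -> dvd_at (mu b) G1 b.
  move=> bs; have ba : b != a by apply: contraNneq as_ => <-.
  apply: dvd_atMr; last exact: den.
  apply: dvd_at_near (quot b ba) _; apply: dvd_atMr; last exact: inv.
  by apply: dF; rewrite inE bs orbT.
have [|G [hG G1E]] := IH G1 us _ hG1 dG1.
  by move=> b bs; apply: sD; rewrite inE bs orbT.
exists G; split=> // z z1; rewrite big_cons -mulrA -G1E // Fg /G1 /blaschke_factor.
have [_ d0] := blaschke_den a1 z1.
by rewrite expr_div_n; field; rewrite expf_neq0.
Qed.

Lemma inner_like_blaschke s mu : supported s mu -> inner_like (blaschke mu).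
Proof.
move=> hs; have [_ sD _] := hs.
apply: (@inner_like_near _ (fun z => \prod_(a <- s) blaschke_factor a z ^+ mu a)).
  by move=> z; rewrite (blaschke_prod _ hs).
apply: inner_like_prod => a as_; apply: inner_likeX.
exact/inner_like_blaschke_factor/sD.
Qed.

End Multiplicities.

(** * Wronskians *)

Section Wronskians.
Context {R : realType}.
Implicit Types (a z : R[i]).

Lemma expands_sum (I : Type) (s : seq I) (F : I -> R[i] -> R[i]) (c : I -> nat -> R[i]) a :
  (forall i, expands (F i) a (c i)) ->
  expands (fun z => \sum_(i <- s) F i z) a (fun k => \sum_(i <- s) c i k).
Proof.
move=> hF; elim: s => [|i s IH].
  apply: expands_ext (expands_near _ (expands_cst 0 a)) => [k|].
    by rewrite big_nil; case: ifP.
  by apply: nearcW => z; rewrite big_nil.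
apply: expands_ext (expands_near _ (expandsD (hF i) IH)) => [k|].
  by rewrite big_cons.
by apply: nearcW => z; rewrite big_cons.
Qed.

(** Columns other than the first contribute off-diagonal entries of [\adj A *m A], which are 0. For
    the Wronskian matrix, the row sums are the derivatives of [f ord_max]. *)
Lemma det_sum_cols n (A : 'M[R[i]]_n.+1) :
  \sum_i (\sum_j A i j) * cofactor A i ord0 = \det A.
Proof.
under eq_bigr => i _ do rewrite mulr_suml.
rewrite exchange_big /= (eq_bigr (fun j => (\det A)%:M ord0 j)); last first.
  move=> j _; rewrite -mul_adj_mx mxE; apply: eq_bigr => i _.
  by rewrite mxE mulrC.
rewrite (bigD1 ord0) //= big1 ?addr0 => [|j j0]; first by rewrite mxE eqxx mulr1n.
by rewrite mxE eq_sym (negbTE j0).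
Qed.

Lemma holo_cofactor n (F : 'I_n -> 'I_n -> R[i] -> R[i]) i0 j0 a :
  (forall i j, holo (F i j) a) ->
  holo (fun z => cofactor (\matrix_(i, j) F i j z) i0 j0) a.
Proof.
move=> hF; have h := holo_det (fun i j => hF (lift i0 i) (lift j0 j)).
apply: holo_near (holoM (holo_cst ((-1) ^+ (i0 + j0)) a) h).
apply: nearcW => z; rewrite /cofactor; congr (_ * \det _).
by apply/matrixP => i j; rewrite !mxE.
Qed.

Context (n : nat) (f : 'I_n.+2 -> R[i] -> R[i]).
Context (f_analytic : forall j, analytic_on_closed_disk (f j)).
Context (f_sum : forall z, nc z <= 1 ->
  f ord_max z = \sum_(j < n.+1) f (widen_ord (leqnSn n.+1) j) z).

Let W := wronskian (fun j : 'I_n.+1 => f (widen_ord (leqnSn n.+1) j)).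

Lemma derive1n_expands j i a c : nc a <= 1 -> expands (f j) a c ->
  expands (f j)^`(i)%classic a (fun k => ((k + i) ^_ i)%:R * c (k + i)%N).
Proof.
move=> a1 hc; have [U [oU DU hU]] := f_analytic j.
apply: (expands_derive1n _ oU _ _ hc).
  by move=> z /hU; exact: holo_analytic.
by apply: DU => /=; rewrite normc_le1.
Qed.

Lemma f_holo j a : nc a <= 1 -> holo (f j) a.
Proof.
move=> a1; have [U [oU DU hU]] := f_analytic j; apply: holo_analytic; apply: hU.
by apply: DU => /=; rewrite normc_le1.
Qed.

Lemma derive1n_holo j i a : nc a <= 1 -> holo (f j)^`(i)%classic a.
Proof.
by move=> a1; have [c hc] := f_holo j a1; eexists; exact: derive1n_expands hc.
Qed.

(** The subtraction is truncated: for m <= n the conclusion is holomorphy alone. *)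
Lemma derive1n_dvd j i m a : nc a <= 1 -> (i <= n)%N -> dvd_at m (f j) a ->
  dvd_at (m - n) (f j)^`(i)%classic a.
Proof.
move=> a1 iN [c [hc c0]]; eexists; split; first exact: derive1n_expands hc.
move=> k km /=; rewrite c0 ?mulr0 //; move: km; rewrite ltn_subRL.
by apply: leq_ltn_trans; rewrite addnC leq_add2r.
Qed.

(** The relation [f_sum] is given on the closed disk, so it can be differentiated at interior
    points, where it holds in a neighbourhood. *)
Lemma derive1n_sum i z : nc z < 1 ->
  (f ord_max)^`(i)%classic z = \sum_(j < n.+1) (f (widen_ord (leqnSn n.+1) j))^`(i)%classic z.
Proof.
move=> z1; have z1' := ltW z1.
have /choice[c hc] : forall j : 'I_n.+1, exists c,
  expands (f (widen_ord (leqnSn n.+1) j)) z c by move=> j; exact: f_holo.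
have hs := expands_sum (index_enum 'I_n.+1) hc.
have hm : expands (f ord_max) z (fun k => \sum_(j < n.+1) c j k).
  apply: expands_near hs; apply/nearcP; exists (1 - nc z) => [|y yz].
    by rewrite subr_gt0.
  by rewrite f_sum //; have := normc_sub_le y z; lra.
rewrite (expands_val (derive1n_expands i z1' hm)) mulr_sumr; apply: eq_bigr => j _.
by rewrite (expands_val (derive1n_expands i z1' (hc j))).
Qed.

Lemma wronskian_holo a : nc a <= 1 -> holo W a.
Proof. by move=> a1; apply: holo_det => i j; exact: derive1n_holo. Qed.

Lemma wronskian_dvd j m a : nc a < 1 -> dvd_at m (f j) a -> dvd_at (m - n) W a.
Proof.
move=> a1 dj; have a1' := ltW a1.
pose M z := \matrix_(i < n.+1, k < n.+1) (f (widen_ord (leqnSn n.+1) k))^`(i)%classic z.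
have hM i k : holo (fun z => cofactor (M z) i k) a.
  by apply: holo_cofactor => i' k'; exact: derive1n_holo.
have dsum k : dvd_at (m - n) (fun z => \sum_(i < n.+1) (f j)^`(i)%classic z * cofactor (M z) i k) a.
  apply: dvd_at_sum => i; apply: dvd_atMr; last exact: hM.
  by apply: derive1n_dvd => //; rewrite -ltnS.
have [jmax|jmax] := eqVneq j ord_max.
  apply: dvd_at_near (dsum ord0); apply/nearcP; exists (1 - nc a) => [|z za].
    by rewrite subr_gt0.
  rewrite /W /wronskian -det_sum_cols; apply: eq_bigr => i _; congr (_ * _).
  rewrite jmax derive1n_sum; last by have := normc_sub_le z a; lra.
  by apply: eq_bigr => k _; rewrite mxE.
have jn : (j < n.+1)%N.
  by have := ltn_ord j; rewrite ltnS leq_eqVlt => /orP[/eqP jE|//]; move/eqP: jmax; case; apply: val_inj.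
apply: dvd_at_near (dsum (Ordinal jn)); apply: nearcW => z.
rewrite /W /wronskian (expand_det_col _ (Ordinal jn)); apply: eq_bigr => i _; congr (_ * _).
by rewrite mxE; congr ((f _)^`(_)%classic z); apply: val_inj.
Qed.

End Wronskians.

(** * Norms and the theorem *)

Section CircleNorm.
Context {R : realType}.
Implicit Types (h : R[i] -> R[i]) (z : R[i]).
Local Notation mu := (@lebesgue_measure R).

(** If the essential supremum were below |h z|, continuity would give an interval of parameters
    inside a null set. This inequality suffices because circle norms occur on the right-hand side of
    the theorem only. *)
Lemma circle_norm_ge h z : (forall a, nc a = 1 -> continuous_atc (fun x => nc (h x)) a) ->
  nc z = 1 -> ((nc (h z))%:E <= norm_circle_infty h)%E.
Proof.
move=> hc z1; have [t0 /andP[t00 t02] zt] := cis_surj z1.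
have pi0 := pi_gt0 R.
rewrite /norm_circle_infty unlock.
set nu := mrestr _ _; pose F (t : R) := (nc (h (cos t +i* sin t)))%:E; rewrite -/F.
have -> : (0 < nu setT)%E.
  rewrite /nu /mrestr setTI lebesgue_measure_itv /= lte_fin mulr_gt0 //.
  by rewrite -EFinB lte_fin subr0 mulr_gt0.
rewrite leNgt; apply/negP => sv.
have [r sr rv] : exists2 r : R, (ess_sup nu (abse \o F) <= r%:E)%E & r < nc (h z).
  move: sv; case: (ess_sup _ _) => [r|//|] sv.
    by exists r; rewrite ?lexx // -lte_fin.
  by exists (nc (h z) - 1); rewrite ?leNye // gtrBl.
have [N [mN N0 subN]] := ess_sup_ge nu (abse \o F).
have e0 : 0 < nc (h z) - r by rewrite subr_gt0.
have := @continuous_atc_cis R (fun x => nc (h x)) 1 t0; rewrite normr1 => /(_ (lexx _)).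
rewrite mul1r -zt => /(_ (hc z z1)) /cvgrPdist_lt/(_ _ e0).
move=> [[A1 A2] /= [A1n A2n] hA].
have A11 : A1 1 by exact: nbhs_singleton A1n.
have [d d0 hd] : exists2 d : R, 0 < d & forall t, `|t0 - t| < d -> A2 t.
  by have /nbhs_ballP[d d0 hd] := A2n; exists d => // t td; apply: hd.
(* t0 may be an endpoint of [0, 2 pi]; the clipped interval still has positive length. *)
pose x := Num.max 0 (t0 - d); pose y := Num.min (2 * pi) (t0 + d).
have xy : x < y by rewrite gt_max !lt_min; apply/andP; split; apply/andP; split; lra.
have sub : `]x, y[ `<=` N `&` `[0%R, 2 * pi : R].
  move=> t; rewrite /= !in_itv /= gt_max lt_min => /andP[/andP[t1 t2] /andP[t3 t4]].
  split; last by rewrite !ltW.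
  apply: subN => /= ht.
  have /hd At : `|t0 - t| < d by rewrite ltr_norml; apply/andP; split; lra.
  have := hA (1, t) (conj A11 At); rewrite /= mul1r => k.
  have : nc (h (cis t)) <= r.
    have := le_trans ht sr; rewrite /F lee_fin ger0_norm ?normc_ge0 //.
  have := ler_norm (nc (h z) - nc (h (cis t))); lra.
have : (mu (`]x, y[%classic : set R) <= nu N)%E.
  apply: le_measure => //; rewrite ?inE; first exact: measurable_itv.
  by apply: measurableI => //; exact: measurable_itv.
move=> k; have : (mu (`]x, y[%classic : set R) <= 0)%E by rewrite -[leRHS]N0.
by rewrite lebesgue_measure_itv /= lte_fin xy -EFinB lee_fin leNgt subr_gt0 xy.
Qed.

End CircleNorm.

Section LambdaNorm.
Context {R : realType}.
Implicit Types (f : R[i] -> R[i]) (w : R -> R).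

Lemma norm_Lambda_ge0 w f : majorant w -> (0 <= norm_Lambda w f)%E.
Proof.
move=> hw; have h0 : nc (0 - (1 / 2)%:C : R[i]) = 1 / 2.
  by rewrite sub0r normcN normc_real ger0_norm.
apply: le_trans (ereal_sup_ubound _); last first.
  exists 0, (1 / 2)%:C; split.
  - by rewrite normr0.
  - by rewrite normc_lt1 normc_real ger0_norm //; lra.
  - by rewrite -subr_eq0 -normc_gt0 h0.
  - reflexivity.
by rewrite lee_fin h0 divr_ge0 ?normc_ge0 // (majorant_ge0 hw) //; lra.
Qed.

Lemma norm_Lambda_lip w f (L : R) : majorant w -> norm_Lambda w f = L%:E ->
  forall z1 z2 : R[i], nc z1 < 1 -> nc z2 < 1 -> z1 != z2 ->
    nc (f z1 - f z2) <= L * w (nc (z1 - z2)).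
Proof.
move=> hw fL z1 z2 n1 n2 z12.
have wp : 0 < w (nc (z1 - z2)).
  by have [h _ _ _ _] := hw; apply: h; rewrite normc_gt0 subr_eq0.
rewrite -ler_pdivrMr // -lee_fin -fL; apply: ereal_sup_ubound.
by exists z1, z2; split; rewrite ?normc_lt1.
Qed.

Lemma norm_Lambda_le w f (L : R) : majorant w ->
  (forall z1 z2 : R[i], nc z1 < 1 -> nc z2 < 1 -> z1 != z2 ->
    nc (f z1 - f z2) <= L * w (nc (z1 - z2))) -> (norm_Lambda w f <= L%:E)%E.
Proof.
move=> hw fL; apply: ge_ereal_sup => _ [z1 [z2 [n1 n2 z12 ->]]].
rewrite !normc_lt1 in n1 n2.
have wp : 0 < w (nc (z1 - z2)).
  by have [h _ _ _ _] := hw; apply: h; rewrite normc_gt0 subr_eq0.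
by rewrite lee_fin ler_pdivrMr // fL.
Qed.

(** The source of the factor n in the theorem, applied to the n-th power of the radical. *)
Lemma normc_subX_unit (x y : R[i]) n : nc x <= 1 -> nc y <= 1 ->
  nc (x ^+ n - y ^+ n) <= n%:R * nc (x - y).
Proof.
move=> x1 y1; case: n => [|n]; first by rewrite subrr Normc.normc0 mul0r.
by have := normc_subX_le n x1 y1; rewrite expr1n mulr1.
Qed.

End LambdaNorm.

Theorem proposition1p2 (R : realType) (w : R -> R) :
  majorant w -> regular w ->
  exists2 c : R, 0 < c &
    forall (n : nat) (f : 'I_n.+2 -> R[i] -> R[i]),
    (1 <= n)%N ->
    (forall j, analytic_on_closed_disk (f j)) ->
    (forall z : R[i], `|z| <= 1 ->
       f ord_max z = \sum_(j < n.+1) f (widen_ord (leqnSn n.+1) j) z) ->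
    let W := wronskian (fun j : 'I_n.+1 => f (widen_ord (leqnSn n.+1) j)) in
    let B := fun j : 'I_n.+2 => blaschke_of (f j) in
    let BL := blaschke_lcm B in
    let BR := blaschke_rad (fun z => \prod_(j < n.+2) B j z) in
    (forall z : R[i], `|z| = 1 -> W z != 0) ->
    (c%:E * norm_Lambda w BL <=
     norm_circle_infty (fun z => (W z)^-1)%R *
     (norm_Lambda w W +
      n%:R%:E * norm_circle_infty W * norm_Lambda w BR))%E.
Proof.
move=> hw [C C0 hC].
have sums := regular_sum_small hw hC; have suml := regular_sum_large hw hC.
(* Product of the constants of [one_sub_inner_le] and [inner_lip]. *)
pose C1 := (2 + 32 * C) * (16 * C + 4).
have C10 : 0 < C1 by rewrite mulr_gt0 //; lra.
exists C1^-1; first by rewrite invr_gt0.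
move=> n f n1 fan fsum W B BL BR Wn0.
have fsum' z : nc z <= 1 -> f ord_max z = \sum_(j < n.+1) f (widen_ord (leqnSn n.+1) j) z.
  by move=> z1; apply: fsum; rewrite normc_le1.
have hW a : nc a <= 1 -> holo W a by exact: wronskian_holo.
have W0 z : nc z = 1 -> W z != 0 by move=> z1; apply: Wn0; exact/normc_eq1.
have jetW a : nc a <= 1 -> jet2 W a.
  move=> a1; have := jet2_div (hW a a1) (holo_cst 1 a) (oner_neq0 _).
  by rewrite (_ : (fun z => _) = W) //; apply/funext => z; rewrite divr1.
have cW a : nc a = 1 -> continuous_atc (fun z => nc (W z)) a.
  by move=> a1; apply: jet2_cts; apply: jetW; rewrite a1.
have cWV a : nc a = 1 -> continuous_atc (fun z => nc (W z)^-1) a.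
  move=> a1; apply: jet2_cts; have a1' : nc a <= 1 by rewrite a1.
  have := jet2_div (holo_cst 1 a) (hW a a1') (W0 a a1).
  by rewrite (_ : (fun z => _) = fun z => (W z)^-1) //; apply/funext => z; rewrite div1r.
have T1 (a : R[i]) : 1 <= nc a <= 1 -> nc a = 1 by move=> h; apply/eqP; rewrite eq_le andbC.
have [zM zM1 hM] := annulus_EVT_max ler01 (lexx 1) (lexx 1) (fun a ha => cW a (T1 a ha)).
(* The minimum of |W| on the circle is obtained as a maximum of |1/W|. *)
have [zm zm1 hm] := annulus_EVT_max ler01 (lexx 1) (lexx 1) (fun a ha => cWV a (T1 a ha)).
have {}zM1 := T1 _ zM1; have {}zm1 := T1 _ zm1.
set M := nc (W zM) in hM.
have m0 : 0 < nc (W zm) by rewrite normc_gt0 W0.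
set m := nc (W zm) in m0.
have {}hM z : nc z = 1 -> nc (W z) <= M by move=> z1; apply: hM; rewrite z1 lexx.
have {}hm z : nc z = 1 -> m <= nc (W z).
  move=> z1; have := hm z; rewrite z1 lexx => /(_ isT).
  by rewrite (normc_inv (W z)) (normc_inv (W zm)) lef_pV2 // posrE normc_gt0 W0.
have M0 : 0 < M by rewrite normc_gt0 W0.
have NM : (M%:E <= norm_circle_infty W)%E by exact: circle_norm_ge.
have Nm : ((m^-1)%:E <= norm_circle_infty (fun z => (W z)^-1)%R)%E.
  by have := circle_norm_ge cWV zm1; rewrite normc_inv.
have nW0 := norm_Lambda_ge0 W hw; have nB0 := norm_Lambda_ge0 BR hw.
have N1 : (0 < norm_circle_infty (fun z => (W z)^-1)%R)%E.
  by apply: lt_le_trans Nm; rewrite lte_fin invr_gt0.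
have N2 : (0 < norm_circle_infty W)%E by apply: lt_le_trans NM; rewrite lte_fin.
have nN2 : (0 < n%:R%:E * norm_circle_infty W)%E.
  by apply: mule_gt0 => //; rewrite lte_fin ltr0n.
(* An infinite Lipschitz norm of W or of the radical makes the right-hand side infinite: its factors
   are positive, by n >= 1 and the nonvanishing of W, so 0 times infinity does not occur. *)
case nWE : (norm_Lambda w W) nW0 => [LW||] nW0 //; last first.
  rewrite addye; last by rewrite gt_eqF // (lt_le_trans (ltNyr 0)) // mule_ge0 // ltW.
  by rewrite gt0_muley // leey.
case nBE : (norm_Lambda w BR) nB0 => [LB||] nB0 //; last first.
  by rewrite gt0_muley // addey // gt0_muley // leey.
rewrite !lee_fin in nW0 nB0.
have /choice[s hs] := fun j => blaschke_of_mult (f j).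
(* A common list of the zeros of all B_j, supporting both the LCM and the radical. *)
pose S := undup (flatten [seq s j | j : 'I_n.+2]).
have S1 a : a \in S -> nc a < 1.
  rewrite mem_undup => /flatten_mapP[j _ aj].
  by have [[_ h _] _] := hs j; exact: h.
have S0 a j : nc a < 1 -> a \notin S -> multiplicity (B j) a = 0%N.
  move=> a1 aS; have [[_ _ h] _] := hs j; apply: h => //.
  apply: contra aS => aj; rewrite mem_undup; apply/flatten_mapP; exists j => //.
  by rewrite mem_enum.
pose muL a := (\max_(j < n.+2) multiplicity (B j) a)%N.
pose PB z := \prod_(j < n.+2) B j z.
pose muR a : nat := (0 < multiplicity PB a)%N.
have multP a : nc a < 1 ->
    multiplicity PB a = (\sum_(j < n.+2) multiplicity (B j) a)%N.
  move=> a1; apply: vanishing_order_mult; apply: vanishing_order_prod => j.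
  by have [_ h] := hs j; have [] := h a a1.
have suppL : supported S muL.
  split; [exact: undup_uniq | exact: S1 |].
  by move=> a a1 aS; apply/eqP; rewrite -leqn0; apply/bigmax_leqP => j _; rewrite S0.
have suppR : supported S muR.
  split; [exact: undup_uniq | exact: S1 |].
  by move=> a a1 aS; rewrite /muR multP // big1 // => j _; exact: S0.
have iL : inner_like BL := inner_like_blaschke suppL.
have iR : inner_like BR := inner_like_blaschke suppR.
have [hR R1 RT _] := iR.
pose F z := W z * BR z ^+ n.
have hF z : nc z <= 1 -> holo F z.
  by move=> z1; apply: holoM; [exact: hW | apply: holoX; exact: hR].
have dF a : a \in S -> dvd_at (muL a) F a.
  move=> aS; have a1 := S1 a aS.
  have cn : (0 < #|'I_n.+2|)%N by rewrite card_ord.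
  have [j jE] := @bigop.eq_bigmax _ (fun j : 'I_n.+2 => multiplicity (B j) a) cn.
  rewrite /muL jE; have [m_eq0|mpos] := posnP (multiplicity (B j) a).
    by rewrite m_eq0; apply: dvd_at0; apply: hF; exact: ltW.
  have [_ hj] := hs j; have [_ dj] := hj a a1.
  have dW := wronskian_dvd fan fsum' a1 (dj mpos).
  have muR1 : muR a = 1%N.
    rewrite /muR multP //; apply/eqP; rewrite eqb1.
    by apply: leq_trans mpos _; rewrite (bigD1 j) //= leq_addr.
  have dR : dvd_at 1 BR a.
    have /vanishing_orderP[c [hc c0 _]] := vanishing_order_blaschke suppR a1.
    by rewrite muR1 in c0; exists c.
  (* The n-th power of the simple zero of the radical makes up for the n orders lost in W; m <= (m -
     n) + n also under truncated subtraction. *)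
  apply: dvd_at_le (dvd_atM dW (dvd_atX n dR)).
  by rewrite mul1n addnC -leq_subLR.
have [G [hG FG]] := divide_blaschke (undup_uniq _) S1 hF dF.
have FBG z : nc z <= 1 -> F z = BL z * G z.
  by move=> z1; rewrite FG // /BL /blaschke_lcm (blaschke_prod _ suppL).
(* A finite Lipschitz constant for F, with the maximum M of |W| on the circle in place of the
   essential supremum; [NM] restores the latter at the end. *)
pose L := LW + n%:R * M * LB.
have L0 : 0 <= L by rewrite addr_ge0 // !mulr_ge0 // ltW.
have WM z : nc z <= 1 -> nc (W z) <= M by exact: holo_max_principle.
have lipW := norm_Lambda_lip hw nWE; have lipR := norm_Lambda_lip hw nBE.
have lipF z1 z2 : nc z1 < 1 -> nc z2 < 1 -> z1 != z2 ->
    nc (F z1 - F z2) <= L * w (nc (z1 - z2)).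
  move=> k1 k2 z12.
  have -> : F z1 - F z2 = (W z1 - W z2) * BR z1 ^+ n + W z2 * (BR z1 ^+ n - BR z2 ^+ n).
    by rewrite /F; ring.
  apply: le_trans (normcD _ _) _; rewrite /L (mulrDl LW) (normcM (W z1 - W z2)) (normcM (W z2)).
  apply: lerD.
    apply: le_trans (lipW _ _ k1 k2 z12); rewrite ler_piMr ?normc_ge0 // normcX.
    by rewrite exprn_ile1 ?normc_ge0 // R1 // ltW.
  have -> : n%:R * M * LB * w (nc (z1 - z2)) = M * (n%:R * (LB * w (nc (z1 - z2)))) by ring.
  apply: ler_pM; rewrite ?normc_ge0 ?WM ?(ltW k2) //.
  apply: le_trans (normc_subX_unit _ (R1 _ (ltW k1)) (R1 _ (ltW k2))) _.
  by rewrite ler_wpM2l // lipR.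
have mF z : nc z = 1 -> m <= nc (F z).
  by move=> z1; rewrite /F normcM normcX RT // expr1n mulr1 hm.
have key := one_sub_inner_le hw suml iL hF hG FBG L0 lipF m0 mF.
pose K := L * (2 + 32 * C) / m.
have K0 : 0 <= K by rewrite divr_ge0 ?(ltW m0) // mulr_ge0 //; lra.
have keyK z : nc z < 1 -> 1 - nc (BL z) <= K * w (1 - nc z).
  move=> z1; have := key z z1.
  rewrite /K [L * (2 + 32 * C) / m * _]mulrAC ler_pdivlMr //; first by rewrite mulrC.
have nL := norm_Lambda_le hw (inner_lip hw sums iL K0 keyK).
apply: (@le_trans _ _ (L / m)%:E).
  apply: (@le_trans _ _ (C1^-1%:E * (K * (16 * C + 4))%:E)%E).
    by apply: lee_wpmul2l => //; rewrite lee_fin invr_ge0 ltW.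
  rewrite -EFinM lee_fin le_eqVlt; apply/orP; left; apply/eqP.
  have c1 : 2 + 32 * C != 0 by rewrite gt_eqF // addr_gt0 ?mulr_gt0.
  have c2 : 16 * C + 4 != 0 by rewrite gt_eqF // addr_gt0 ?mulr_gt0.
  by rewrite /K /C1; field; rewrite (gt_eqF m0) c1 c2.
have LE : (LW%:E + n%:R%:E * M%:E * LB%:E)%E = L%:E by rewrite /L EFinD !EFinM.
have -> : (L / m)%:E = ((m^-1)%:E * (LW%:E + n%:R%:E * M%:E * LB%:E))%E.
  by rewrite LE -EFinM mulrC.
apply: lee_pmul => //; first by rewrite lee_fin invr_ge0 ltW.
apply: leeD2l; apply: lee_wpmul2r; first by rewrite lee_fin.
by apply: lee_wpmul2l => //; rewrite lee_fin.
Qed.
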